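(* For all integers $k,n\ge 1$, there exists a biLipschitz embedding $\phi:\mathbb{S}^n\to J^k(\mathbb{R}^n)$ that does not admit a Lipschitz extension $\tilde\phi:\mathbb{B}^{n+1}\to J^k(\mathbb{R}^n)$.
   Context: $\mathbb{B}^{n+1}\subset\mathbb{R}^{n+1}$ is the closed Euclidean unit ball and $\mathbb{S}^n=\partial\mathbb{B}^{n+1}$ is the unit sphere, both with the Euclidean metric (on $\mathbb{S}^n$ one may equivalently use the geodesic path metric, as the two are biLipschitz equivalent). Jet space: for a multi-index $I=(i_1,\dots,i_n)$ of non-negative integers put $|I|=i_1+\cdots+i_n$. For $f\in C^k(\mathbb{R}^n)$ and $x_0\in\mathbb{R}^n$, the $k$-jet $j^k_{x_0}(f)$ is the class of $f$ under the relation of having the same $k$-th order Taylor polynomial at $x_0$; $J^k(\mathbb{R}^n)$ is the set of all $k$-jets at all points. It is identified with a Euclidean space by the global coordinates $(x,(u_I)_{|I|\le k})$, where $x(j^k_{x_0}(f))=x_0$ and $u_I(j^k_{x_0}(f))=\partial_I f(x_0)$. The horizontal bundle is framed by the vector fields $X_j^{(k)}=\frac{\partial}{\partial x_j}+\sum_{|I|\le k-1}u_{I+e_j}\frac{\partial}{\partial u_I}$ ($j=1,\dots,n$) and $\frac{\partial}{\partial u_I}$ ($|I|=k$), which are declared orthonormal. A path is horizontal if it is absolutely continuous (as a map into Euclidean space) and its derivative lies a.e. in the horizontal bundle; its length is the integral of the norm of its derivative in this inner product. $J^k(\mathbb{R}^n)$ carries the Carnot-Carathéodory metric $d_{cc}$: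 $d_{cc}(p,q)$ is the infimum of lengths of horizontal paths from $p$ to $q$. A map $g:(X,d_X)\to(Y,d_Y)$ is a biLipschitz embedding if there is $C\ge1$ with $\frac1C d_X(a,b)\le d_Y(g(a),g(b))\le C d_X(a,b)$ for all $a,b\in X$. *)

(* Defs.v *)
From HB Require Import structures.
From mathcomp Require Import all_boot all_order all_algebra.
From mathcomp Require Import all_classical all_reals all_analysis.
(* The notations of mpoly clash with those of MathComp-Analysis. *)
From mathcomp Require mpoly.
Import -(notations) mpoly.

Set Implicit Arguments.
Unset Strict Implicit.
Unset Printing Implicit Defensive.

Import Order.TTheory GRing.Theory Num.Theory.
Import numFieldNormedType.Exports.

Local Open Scope classical_set_scope.
Local Open Scope ring_scope.

(* ['rV[R]_m] carries the sup norm in the library, hence an explicit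
   Euclidean norm. *)
Definition euclid_norm (R : realType) (m : nat) (v : 'rV[R]_m) : R :=
  Num.sqrt (\sum_(i < m) v 0 i ^+ 2).

Definition euclid_dist (R : realType) (m : nat) (v w : 'rV[R]_m) : R :=
  euclid_norm (v - w).

Definition euclid_ball (R : realType) (m : nat) : set 'rV[R]_m :=
  [set v | euclid_norm v <= 1].

Definition euclid_sphere (R : realType) (m : nat) : set 'rV[R]_m :=
  [set v | euclid_norm v = 1].

(* The target distance takes values in [\bar R]: a Carnot-Caratheodory distance
   is an infimum, a priori over an empty set. *)
Definition Lipschitz_map (R : realType) (X Y : Type)
    (dX : X -> X -> R) (dY : Y -> Y -> \bar R) (A : set X) (f : X -> Y) : Prop :=
  exists2 C : R, 0 <= C &
    forall a b, A a -> A b -> (dY (f a) (f b) <= (C * dX a b)%:E)%E.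

Definition biLipschitz_embedding (R : realType) (X Y : Type)
    (dX : X -> X -> R) (dY : Y -> Y -> \bar R) (A : set X) (f : X -> Y) : Prop :=
  exists2 C : R, 1 <= C &
    forall a b, A a -> A b ->
      ((C^-1 * dX a b)%:E <= dY (f a) (f b))%E /\
      (dY (f a) (f b) <= (C * dX a b)%:E)%E.

Definition abs_continuous (R : realType) (T : Type) (d : T -> T -> R)
    (a b : R) (g : R -> T) : Prop :=
  forall e : R, 0 < e -> exists2 r : R, 0 < r &
    forall (m : nat) (s t : 'I_m -> R),
      (forall i, [/\ a <= s i, s i <= t i & t i <= b]) ->
      trivIset setT (fun i => `]s i, t i[%classic) ->
      \sum_(i < m) (t i - s i) < r ->
      \sum_(i < m) d (g (s i)) (g (t i)) < e.

(* [bmultinom n k.+1] is the type of multi-indices [I] in [n] variables with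
   [mdeg I <= k]. *)
Notation midx n k := (bmultinom n k.+1).

(* A jet is given by its global coordinates [(x, (u_I)_(|I| <= k))]; the same
   type serves for tangent vectors. *)
Definition jet (R : realType) (n k : nat) : Type :=
  ('rV[R]_n * {ffun midx n k -> R})%type.

Definition jet_dist (R : realType) (n k : nat) (p q : jet R n k) : R :=
  Num.sqrt (\sum_(j < n) (p.1 0 j - q.1 0 j) ^+ 2
            + \sum_(I : midx n k) (p.2 I - q.2 I) ^+ 2).

(* [I + e_j] when [mdeg I < k], see [midx_succE]; [I] otherwise. *)
Definition midx_succ (n k : nat) (I : midx n k) (j : 'I_n) : midx n k :=
  insubd I (mnm_add (bmnm I) (mnm1 j)).

Lemma midx_succE (n k : nat) (I : midx n k) (j : 'I_n) :
  (mdeg (bmnm I) < k)%N ->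
  bmnm (midx_succ I j) = mnm_add (bmnm I) (mnm1 j).
Proof.
move=> Ik; apply: (insubdK I).
by rewrite unfold_in mdegD mdeg1 addn1 ltnS.
Qed.

Definition ddx (R : realType) (n k : nat) (j : 'I_n) : jet R n k :=
  (delta_mx 0 j, 0).

Definition ddu (R : realType) (n k : nat) (I : midx n k) : jet R n k :=
  (0, [ffun J => (J == I)%:R]).

Definition Xfield (R : realType) (n k : nat) (j : 'I_n) (p : jet R n k) :
    jet R n k :=
  ddx R k j
  + \sum_(I : midx n k | (mdeg (bmnm I) < k)%N) p.2 (midx_succ I j) *: ddu R I.

Definition frame_idx (n k : nat) : finType :=
  ('I_n + {I : midx n k | mdeg (bmnm I) == k})%type.

Definition frame (R : realType) (n k : nat) (p : jet R n k)
    (i : frame_idx n k) : jet R n k :=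
  match i with
  | inl j => Xfield j p
  | inr J => ddu R (val J)
  end.

Definition frame_comb (R : realType) (n k : nat) (p : jet R n k)
    (c : {ffun frame_idx n k -> R}) : jet R n k :=
  \sum_(i : frame_idx n k) c i *: frame p i.

Definition horizontal (R : realType) (n k : nat) (p v : jet R n k) : Prop :=
  exists c : {ffun frame_idx n k -> R}, v = frame_comb p c.

(* The norm making the frame orthonormal; the coefficients of a horizontal
   vector are unique by [frame_comb_inj]. *)
Definition hnorm (R : realType) (n k : nat) (p v : jet R n k) : R :=
  let c := xget 0 [set c | v = frame_comb p c] in
  Num.sqrt (\sum_(i : frame_idx n k) c i ^+ 2).

Definition jet_derivable (R : realType) (n k : nat) (g : R -> jet R n k)
    (t : R) : Prop :=
  (forall j : 'I_n, derivable (fun s => (g s).1 0 j) t 1) /\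
  (forall I : midx n k, derivable (fun s => (g s).2 I) t 1).

Definition velocity (R : realType) (n k : nat) (g : R -> jet R n k) (t : R) :
    jet R n k :=
  (\row_(j < n) derive1 (fun s => (g s).1 0 j) t,
   [ffun I => derive1 (fun s => (g s).2 I) t]).

Definition horizontal_path (R : realType) (n k : nat) (a b : R)
    (g : R -> jet R n k) : Prop :=
  [/\ a <= b,
      abs_continuous (@jet_dist R n k) a b g
    & {ae @lebesgue_measure R, forall t, `[a, b]%classic t ->
        jet_derivable g t /\ horizontal (g t) (velocity g t)}].

Definition path_length (R : realType) (n k : nat) (a b : R)
    (g : R -> jet R n k) : \bar R :=
  (\int[@lebesgue_measure R]_(t in `[a, b]%classic)
     (hnorm (g t) (velocity g t))%:E)%E.

Definition dcc (R : realType) (n k : nat) (p q : jet R n k) : \bar R :=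
  ereal_inf [set L | exists (a b : R) (g : R -> jet R n k),
    [/\ horizontal_path a b g, g a = p, g b = q & L = path_length a b g]].

Lemma frame_comb_fst (R : realType) (n k : nat) (p : jet R n k)
    (c : {ffun frame_idx n k -> R}) (j : 'I_n) :
  (frame_comb p c).1 0 j = c (inl j).
Proof.
have sum1 (J : finType) (P : pred J) (F : J -> jet R n k) :
    (\sum_(i | P i) F i).1 0 j = \sum_(i | P i) (F i).1 0 j.
  by apply: (big_morph (fun v : jet R n k => v.1 0 j)) => [x y|]; rewrite mxE.
have X1 i : (Xfield i p).1 0 j = (j == i)%:R.
  rewrite /Xfield [LHS]mxE sum1 big1 ?addr0 => [|L _]; last by rewrite !mxE mulr0.
  by rewrite mxE eqxx.
rewrite /frame_comb sum1 big_sumType /= [X in _ + X]big1 ?addr0; last first.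
  by move=> J _; rewrite !mxE mulr0.
rewrite (eq_bigr (fun i => c (inl i) * (j == i)%:R)) => [|i _]; last first.
  by rewrite -X1 mxE.
rewrite (bigD1 j) //= eqxx mulr1 big1 ?addr0 => // i ij.
by rewrite eq_sym (negbTE ij) mulr0.
Qed.

Lemma frame_comb_snd (R : realType) (n k : nat) (p : jet R n k)
    (c : {ffun frame_idx n k -> R}) (I : {I : midx n k | mdeg (bmnm I) == k}) :
  (frame_comb p c).2 (val I) = c (inr I).
Proof.
have sum2 (J : finType) (P : pred J) (F : J -> jet R n k) (K : midx n k) :
    (\sum_(i | P i) F i).2 K = \sum_(i | P i) (F i).2 K.
  by apply: (big_morph (fun v : jet R n k => v.2 K)) => [x y|]; rewrite ffunE.
have Z2 a (v : jet R n k) K : (a *: v).2 K = a * v.2 K by exact: ffunE.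
have U2 (L K : midx n k) : (ddu R L).2 K = (K == L)%:R by exact: ffunE.
rewrite /frame_comb sum2 big_sumType big1; last first.
  move=> j _; rewrite Z2 /frame /Xfield [X in _ * X]ffunE sum2 ffunE add0r.
  rewrite big1 ?mulr0// => L Lk.
  rewrite Z2 U2; case: eqVneq => [IL|_]; last by rewrite mulr0.
  by move: Lk; rewrite -IL (eqP (valP I)) ltnn.
rewrite (bigD1 I)// Z2 U2 eqxx mulr1 big1 => [|L LI]; first by rewrite /= add0r addr0.
by rewrite Z2 U2 (inj_eq val_inj) eq_sym (negbTE LI) mulr0.
Qed.

Lemma frame_comb_inj (R : realType) (n k : nat) (p : jet R n k) :
  injective (frame_comb p).
Proof.
move=> c d cd; apply/ffunP => -[j|J].
  by rewrite -(frame_comb_fst p c) cd frame_comb_fst.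
by rewrite -(frame_comb_snd p c) cd frame_comb_snd.
Qed.

(* Main.v *)
(* Map the two hemispheres of the sphere onto the closed unit ball of R^n and lift them by
   the jets of f = (1 - |x|^2)^(k+1) and of the zero function. Both jets agree over the
   boundary of the ball, and straight segments lift to horizontal paths, so the map is
   Lipschitz. A horizontal path of length L leaving a zero jet has |u_0| <= n^k L^(k+1);
   hence a point of the first sheet over x is at distance at least (1 - |x|)/n from the
   second sheet, and the map is biLipschitz.

   A Lipschitz map psi into the jet space satisfies, with U = u_0, P_j = u_(e_j) and X = x,
     |U b - U a - P a . (X b - X a)| <= C |a - b|^2,
   so (X, U) o psi maps a simplex of size 1/N to a simplex of volume O(N^-(n+2)). If psi
   extended the embedding, then, over a Kuhn triangulation of an (n+1)-cube into
   O(N^(n+1)) such simplices, the sum of the signed volumes of the images would tend to 0.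
   That sum only depends on the boundary values, for which it is a Riemann sum of the
   volume enclosed between the graphs of f and of 0. *)
Require Import Defs.
From mathcomp Require Import all_boot all_order all_fingroup all_algebra.
From mathcomp Require Import all_classical all_reals all_analysis.
From mathcomp Require Import measurable_realfun zify ring lra.
From mathcomp Require mpoly.
Import -(notations) mpoly.

Set Implicit Arguments.
Unset Strict Implicit.
Unset Printing Implicit Defensive.

Import Order.TTheory GRing.Theory Num.Theory.
Import numFieldNormedType.Exports.

Local Open Scope ring_scope.

(** * Discrete Stokes formula on the Kuhn triangulation *)

(** The exponent [k + 1] of f does two things. Every derivative of f of order at most k keeps a
    factor [1 - |x|^2], so the two sheets of jets glue along the boundary. And f is at least
    [(1 - |x|)^(k+1)], the power that matches the weight of [u_0], so the gap between the sheets is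
    linear in [1 - |x|]. The quadratic contact error comes from freezing P at the start of a short
    horizontal path: P is itself a fiber coordinate, hence moves by O(|a - b|), and it is multiplied
    by a base displacement of the same size. This requires bounded fiber coordinates, which a
    Lipschitz map on a ball has. Only the contact relation between [u_0] and the [u_(e_j)] is used,
    and it holds since k >= 1. The extension is never differentiated: inner facets cancel by
    combinatorics alone, and the map enters only through its values at grid vertices. Since the grid
    fills a cube and the extension lives on a round ball, the map is carried over through a prism
    and a double cone, and continued by zero jets outside the prism; the contact estimate must then
    be checked across the seam. *)

(** A simplex is the alternating sum of the cones from the origin over its facets. Border the rows
    [p i] by a column of ones: expansion along that column gives the right-hand side, and
    subtracting consecutive rows, which is multiplication by the unitriangular [L], leaves the
    left-hand side as the only minor. *)
Lemma det_differences (R : comNzRingType) (m : nat) (p : nat -> 'rV[R]_m) :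
  \det (\matrix_(i < m) (p i.+1 - p i)) =
  \sum_(i < m.+1) (-1) ^+ i * \det (\matrix_(j < m) p (lift i j)).
Proof.
pose A : 'M[R]_m.+1 := \matrix_(i < m.+1, j < 1 + m) row_mx 1 (p i) 0 j.
have A0 i : A i 0 = 1.
  rewrite mxE; have -> : 0 = lshift m 0 :> 'I_(1 + m) by apply: val_inj.
  by rewrite row_mxEl mxE.
have AS i j : A i (lift 0 j) = p i 0 j.
  rewrite mxE; have -> : lift 0 j = rshift 1 j :> 'I_(1 + m) by apply: val_inj.
  by rewrite row_mxEr.
have -> : \sum_(i < m.+1) (-1) ^+ i * \det (\matrix_(j < m) p (lift i j)) = \det A.
  rewrite (expand_det_col A 0); apply: eq_bigr => i _.
  rewrite A0 mul1r /cofactor addn0.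
  have -> : row' i (col' 0 A) = \matrix_(j < m) p (lift i j) :> 'M[R]_m; last by [].
  by apply/matrixP => j l; rewrite [LHS]mxE [LHS]mxE AS mxE.
pose L : 'M[R]_m.+1 := \matrix_(i, j) ((i == j)%:R - (i == j.+1 :> nat)%:R).
have detL : \det L = 1.
  rewrite det_trig; last first.
    apply/is_trig_mxP => i j ij; rewrite mxE (_ : (i == j) = false); last by rewrite -val_eqE /=; lia.
    by rewrite (_ : (_ == _.+1) = false) ?subr0//; lia.
  apply: big1 => i _; rewrite mxE eqxx (_ : (_ == _.+1) = false) ?subr0//; lia.
have LA i j : (L *m A) i j = if unlift 0 i is Some i' then A i j - A (widen_ord (leqnSn m) i') j
                             else A i j.
  rewrite mxE; under eq_bigr do rewrite mxE mulrBl.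
  rewrite sumrB (bigD1 i)//= eqxx mul1r big1 ?addr0 => [|l li]; last first.
    by rewrite eq_sym (negPf li) mul0r.
  case: unliftP => [i' ->|->].
    rewrite (bigD1 (widen_ord (leqnSn m) i'))//= eqxx mul1r big1 ?addr0// => l.
    move=> li; rewrite (_ : (_ == _) = false) ?mul0r//.
    by apply: contra_neqF li => /eqP h; apply: val_inj => /=; move: h; rewrite /= /bump; lia.
  by rewrite big1 ?subr0// => l _; rewrite mul0r.
rewrite -[RHS]mul1r -detL -det_mulmx (expand_det_col _ 0) big_ord_recl big1.
  rewrite addr0 LA unlift_none A0 mul1r /cofactor mul1r; congr (determinant _).
  by apply/matrixP => i j; rewrite [RHS]mxE [in RHS]mxE LA liftK !AS !mxE.
by move=> i _; rewrite LA liftK !A0 subrr mul0r.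
Qed.

(* The simplex [q] of the cube at [v] is the monotone path from [v] to [v + (1, ..., 1)]
   whose step in direction [d] comes in position [q d]. *)
Definition kuhn_vertex (m : nat) (v : {ffun 'I_m -> nat}) (q : 'S_m) (i : nat) :
    {ffun 'I_m -> nat} :=
  [ffun d => (v d + (q d < i))%N].

(** With the factor [(-1) ^+ q], this is [m!] times the signed volume of the simplex spanned by the
    images of the vertices. *)
Definition simplex_det (R : comNzRingType) (m : nat) (h : {ffun 'I_m -> nat} -> 'rV[R]_m)
    (v : {ffun 'I_m -> nat}) (q : 'S_m) : R :=
  \det (\matrix_(i < m) (h (kuhn_vertex v q i.+1) - h (kuhn_vertex v q i))).

Definition facet_det (R : comNzRingType) (m : nat) (h : {ffun 'I_m -> nat} -> 'rV[R]_m)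
    (v : {ffun 'I_m -> nat}) (q : 'S_m) (i : 'I_m.+1) : R :=
  \det (\matrix_(j < m) h (kuhn_vertex v q (lift i j))).

(* Exchanging the steps [i - 1] and [i] keeps the facet and reverses the sign. *)
Lemma facet_det_inner (R : comNzRingType) (m : nat) (h : {ffun 'I_m -> nat} -> 'rV[R]_m)
    (v : {ffun 'I_m -> nat}) (i : 'I_m.+1) :
  (0 < i < m)%N -> \sum_(q : 'S_m) (-1) ^+ q * facet_det h v q i = 0.
Proof.
move=> /andP[i0 im].
have im1 : (i.-1 < m)%N by lia.
pose a := Ordinal im1; pose b := Ordinal im.
have ab : a != b by rewrite -val_eqE /=; lia.
pose t := tperm a b.
rewrite (bigID (fun q : 'S_m => odd_perm q)) /=.
rewrite [X in _ + X](reindex_inj (mulIg t)) /=.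
rewrite [X in _ + X](eq_bigl (fun q : 'S_m => odd_perm q)); last first.
  by move=> q; rewrite odd_permM odd_tperm ab /= addbT negbK.
rewrite -big_split /=; apply: big1 => q _.
rewrite odd_permM odd_tperm ab signr_addb expr1 mulrN1 mulNr.
apply/eqP; rewrite subr_eq0; apply/eqP; congr (_ * determinant _).
apply/matrixP => j l; rewrite !mxE; congr (h _ 0 _); apply/ffunP => d.
rewrite !ffunE permM; congr (_ + nat_of_bool _)%N.
have /= : bump i j != i by rewrite /bump; lia.
rewrite /=.
move: (bump i j) => e; case: tpermP => [->|->|//]; rewrite /a /b /=; lia.
Qed.

Definition shift_vertex (m : nat) (v : {ffun 'I_m -> nat}) (d : 'I_m) :
    {ffun 'I_m -> nat} :=
  [ffun e => (v e + (e == d))%N].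

(* Moving the first step of a path to the end identifies its facet opposite to the first
   vertex with a facet, opposite to the last vertex, of the shifted cube. *)
Lemma simplex_det_boundary (R : comNzRingType) (m : nat)
    (h : {ffun 'I_m.+1 -> nat} -> 'rV[R]_m.+1) (v : {ffun 'I_m.+1 -> nat}) :
  \sum_(q : 'S_m.+1) (-1) ^+ q * simplex_det h v q =
  (-1) ^+ m * \sum_(q : 'S_m.+1) (-1) ^+ q *
    (facet_det h (shift_vertex v (q^-1%g ord_max)) q ord_max - facet_det h v q ord_max).
Proof.
under eq_bigr do rewrite /simplex_det (det_differences (fun i => h (kuhn_vertex v _ i))) mulr_sumr.
rewrite exchange_big /= big_ord_recl /= big_ord_recr /= [X in _ + (X + _)]big1 ?add0r.
  (* [c] sends position 0 to the last one and lowers every other position by one; its sign is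
     [(-1) ^+ m]. *)
  pose c : 'S_m.+1 := lift_perm ord0 ord_max 1%g.
  rewrite (eq_bigr (fun q : 'S_m.+1 => (-1) ^+ m * ((-1) ^+ (q * c)%g *
      facet_det h (shift_vertex v ((q * c)^-1%g ord_max)) (q * c)%g ord_max))); last first.
    move=> q _; rewrite odd_permM odd_lift_perm odd_perm1 /= addbF signr_addb.
    rewrite signr_odd expr0 mul1r mulrA mulrCA -exprD addnn -(signr_odd _ m.*2) odd_double mulr1.
    congr (_ * determinant _).
    apply/matrixP => j l; rewrite !mxE; congr (h _ 0 _); apply/ffunP => d.
    rewrite !ffunE -[d == _](inj_eq (@perm_inj _ (q * c)%g)) permKV permM.
    rewrite -addnA; congr (_ + _)%N => /=.
    rewrite /bump leq0n add1n (_ : (m < j)%N = false); last by have := ltn_ord j; lia.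
    case: (unliftP ord0 (q d)) => [e ->|->] /=.
      rewrite lift_perm_lift perm1 -val_eqE /= /bump /=; have := ltn_ord j; have := ltn_ord e; lia.
    by rewrite lift_perm_id eqxx /=; have := ltn_ord j; lia.
  rewrite -mulr_sumr -(reindex_inj (mulIg c) (P := xpredT) (F := fun q : 'S_m.+1 => (-1) ^+ q *
      facet_det h (shift_vertex v (q^-1%g ord_max)) q ord_max)) /=.
  under [X in _ = _ * X]eq_bigr do rewrite mulrBr.
  rewrite sumrB mulrBr; congr (_ + _).
  rewrite mulr_sumr -sumrN.
  have E (q : 'S_m.+1) : (-1) ^+ q * ((-1) ^+ bump 0 m *
      \det (\matrix_(j < m.+1) h (kuhn_vertex v q (bump (bump 0 m) j)))) =
      - ((-1) ^+ m * ((-1) ^+ q * facet_det h v q ord_max)).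
    by rewrite mulrCA /bump leq0n exprS mulN1r mulNr.
  by under eq_bigr do rewrite E.
move=> i _; transitivity ((-1) ^+ (bump 0 i) * \sum_(q : 'S_m.+1) (-1) ^+ q *
    facet_det h v q (lift ord0 (widen_ord (leqnSn m) i))).
  by rewrite mulr_sumr; apply: eq_bigr => q _; rewrite mulrCA.
rewrite facet_det_inner ?mulr0//= /bump; have := ltn_ord i; lia.
Qed.

Definition nat_vertex (m N : nat) (v : {ffun 'I_m -> 'I_N}) : {ffun 'I_m -> nat} :=
  [ffun d => v d : nat].

Lemma telescope_grid (V : zmodType) (m N : nat) (G : {ffun 'I_m -> nat} -> V) (d : 'I_m) :
  (forall v : {ffun 'I_m -> nat}, (v d == 0%N) || (v d == N) -> G v = 0) ->
  \sum_(v : {ffun 'I_m -> 'I_N}) (G (shift_vertex (nat_vertex v) d) - G (nat_vertex v)) = 0.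
Proof.
move=> G0; rewrite sumrB; apply/eqP; rewrite subr_eq0; apply/eqP.
(* The cyclic shift of coordinate [d] permutes the cubes. It realises [shift_vertex] except at the
   wrap-around, where both terms lie on extreme layers and vanish. *)
pose s (v : {ffun 'I_m -> 'I_N}) : {ffun 'I_m -> 'I_N} :=
  [ffun e => if e == d then ordS (v e) else v e].
have sI : injective s.
  move=> v w /ffunP vw; apply/ffunP => e; move: (vw e); rewrite !ffunE.
  by case: eqP => // _; exact: ordS_inj.
rewrite [RHS](reindex_inj sI) /=; apply: eq_bigr => v _.
case: (eqVneq (v d).+1 N) => vN.
  rewrite !G0// !ffunE !eqxx /=; last by rewrite addn1 vN eqxx orbT.
  by rewrite vN modnn.
congr (G _); apply/ffunP => e; rewrite !ffunE; case: eqP => [->|_]; last by rewrite addn0.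
by rewrite addn1 /= modn_small// ltn_neqAle vN ltn_ord.
Qed.

(** For fixed [q], the facet opposite to the last vertex is constant in the direction [d] of the
    last step. Hence the difference of the facet terms of [g] and [h] vanishes on the two extreme
    layers in direction [d], and the sum over the grid telescopes. *)
Lemma discrete_Stokes (R : comNzRingType) (m N : nat)
    (g h : {ffun 'I_m.+1 -> nat} -> 'rV[R]_m.+1) :
  (forall v : {ffun 'I_m.+1 -> nat}, (forall d, v d <= N)%N ->
     (exists d, (v d == 0%N) || (v d == N)) -> g v = h v) ->
  \sum_(v : {ffun 'I_m.+1 -> 'I_N}) \sum_(q : 'S_m.+1)
     (-1) ^+ q * simplex_det g (nat_vertex v) q =
  \sum_(v : {ffun 'I_m.+1 -> 'I_N}) \sum_(q : 'S_m.+1)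
     (-1) ^+ q * simplex_det h (nat_vertex v) q.
Proof.
move=> gh; under eq_bigr do rewrite simplex_det_boundary.
under [RHS]eq_bigr do rewrite simplex_det_boundary.
rewrite -!mulr_sumr; congr (_ * _); rewrite exchange_big [RHS]exchange_big /=.
apply: eq_bigr => q _; rewrite -!mulr_sumr; congr (_ * _).
set d := (q^-1%g ord_max).
(* The values of [g] and [h] are compared only at vertices of the grid, whereas [telescope_grid]
   speaks of all integer points; hence the cut-off to 0 elsewhere. *)
pose G (v : {ffun 'I_m.+1 -> nat}) : R := if [forall e, (e == d) || (v e < N)%N] && (v d <= N)%N
  then facet_det g v q ord_max - facet_det h v q ord_max else 0.
apply/eqP; rewrite -subr_eq0 -sumrB; apply/eqP.
rewrite -[RHS](@telescope_grid R m.+1 N G d); last first.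
  move=> v vd; rewrite /G; case: ifP => // /andP[/forallP vN vdN].
  apply/eqP; rewrite subr_eq0; apply/eqP; congr (determinant _).
  apply/matrixP => i j; rewrite !mxE; congr (fun_of_matrix _ 0 j); apply: gh.
    move=> e; rewrite ffunE; move: (vN e); case: eqP => [->|_] /= ve.
      by rewrite /d permKV /= /bump (_ : (m < _)%N = false) ?addn0//; have := ltn_ord i; lia.
    by case: (_ < _)%N; lia.
  exists d; rewrite ffunE permKV /= /bump (_ : (m < _ + _)%N = false) ?addn0//.
  by have := ltn_ord i; lia.
apply: eq_bigr => v _; rewrite /G !ifT.
- by rewrite !opprB addrACA [in RHS]addrACA; congr (_ + _); rewrite [RHS]addrC.
- by apply/andP; split; [apply/forallP => e|]; rewrite ffunE ?ltn_ord ?orbT// ltnW.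
- apply/andP; split; last by rewrite !ffunE eqxx addn1.
  by apply/forallP => e; rewrite !ffunE; case: eqP => //= _; rewrite addn0 ltn_ord.
Qed.

(** * Volume obstruction for maps satisfying a contact inequality *)

(** Multiplication by the unitriangular [T] subtracts from the last column the combination of the
    others with coefficients [P]. Each of the [(n+1)!] terms of the Leibniz formula then has one
    factor bounded by [B] and [n] factors bounded by [A]. *)
Lemma norm_det_le (R : realFieldType) (n : nat) (M : 'M[R]_n.+1) (P : 'I_n -> R) (A B : R) :
  0 <= A -> 0 <= B ->
  (forall i j, `|M i (lift ord_max j)| <= A) ->
  (forall i, `|M i ord_max - \sum_(j < n) P j * M i (lift ord_max j)| <= B) ->
  `|\det M| <= (n.+1)`!%:R * A ^+ n * B.
Proof.
move=> A0 B0 MA MB.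
pose T : 'M[R]_n.+1 := \matrix_(l, j)
  ((l == j)%:R - (if unlift ord_max l is Some l' then P l' else 0) *+ (j == ord_max)).
have detT : \det T = 1.
  rewrite -det_tr det_trig.
    apply: big1 => i _; rewrite !mxE eqxx; case: unliftP => [i' ->|->].
      by rewrite eq_sym (negPf (neq_lift _ _)) subr0.
    by rewrite mul0rn subr0.
  apply/is_trig_mxP => i j ij; rewrite !mxE (_ : (j == i) = false); last first.
    by rewrite -val_eqE /=; lia.
  rewrite (_ : (i == _) = false) ?subr0//.
  by rewrite -val_eqE /=; have := ltn_ord j; lia.
have MT1 i j : (M *m T) i (lift ord_max j) = M i (lift ord_max j).
  rewrite mxE (bigD1 (lift ord_max j))//= mxE eqxx [_ == ord_max]eq_sym.
  rewrite (negPf (neq_lift _ _)) subr0 mulr1 big1 ?addr0// => l lj.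
  by rewrite mxE (negPf lj) [_ == ord_max]eq_sym (negPf (neq_lift _ _)) subrr mulr0.
have MT2 i : (M *m T) i ord_max = M i ord_max - \sum_(j < n) P j * M i (lift ord_max j).
  rewrite mxE (bigD1_ord ord_max)//= mxE eqxx unlift_none mul0rn subr0 mulr1; congr (_ + _).
  rewrite -sumrN; apply: eq_bigr => j _.
  by rewrite mxE liftK eq_sym (negPf (neq_lift _ _)) eqxx sub0r mulrN mulrC.
have -> : \det M = \det (M *m T) by rewrite det_mulmx detT mulr1.
set N := M *m T.
apply: le_trans (ler_norm_sum _ _ _) _.
rewrite -mulrA mulr_natl -card_Sn -sumr_const.
rewrite (eq_bigl predT) => [|s]; last by rewrite inE.
apply: ler_sum => s _; rewrite normrM normrX normrN1 expr1n mul1r normr_prod.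
rewrite (bigD1 (s^-1%g ord_max))//= permKV mulrC; apply: ler_pM => //.
- by apply: prodr_ge0.
- rewrite (_ : A ^+ n = \prod_(i | i != s^-1%g ord_max) A); last first.
    rewrite big_const iter_mulr_1; congr (_ ^+ _).
    rewrite (eq_card (B := predC1 (s^-1%g ord_max))); last by move=> i; rewrite !inE.
    by rewrite cardC1 card_ord.
  apply: ler_prod => i im; rewrite normr_ge0 /=.
  have : s i != ord_max by apply: contraNneq im => <-; rewrite permK.
  by rewrite eq_sym => /unlift_some[j -> _]; rewrite /N MT1.
- by rewrite /N MT2.
Qed.

(** Sorting the rows by the direction of their step absorbs the sign of [q]. A step in a base
    direction moves only that base coordinate, by [e], so the sorted matrix is triangular; its last
    diagonal entry is the rise of the height along the vertical step. *)
Lemma simplex_det_graph (R : realFieldType) (n : nat) (a e : R)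
    (h : {ffun 'I_n.+1 -> nat} -> 'rV[R]_n.+1) (v : {ffun 'I_n.+1 -> nat}) (q : 'S_n.+1) :
  (forall w j, h w 0 (lift ord_max j) = a + e * (w (lift ord_max j))%:R) ->
  (-1) ^+ q * simplex_det h v q =
  e ^+ n * (h (kuhn_vertex v q (q ord_max).+1) 0 ord_max
            - h (kuhn_vertex v q (q ord_max)) 0 ord_max).
Proof.
move=> hX; rewrite -det_perm -det_mulmx -row_permE -det_tr det_trig.
  rewrite big_ord_recr /= !mxE; congr (_ * _).
  rewrite (eq_bigr (fun=> e)) => [|j _]; first by rewrite prodr_const card_ord.
  rewrite !mxE (_ : widen_ord _ j = lift ord_max j); last first.
    by apply: val_inj; rewrite /= /bump (_ : (n <= j)%N = false)//; have := ltn_ord j; lia.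
  rewrite !hX !ffunE ltnSn ltnn !natrD /=; ring.
apply/is_trig_mxP => i j ij; rewrite !mxE.
have : i != ord_max by rewrite -val_eqE /=; have := ltn_ord j; lia.
rewrite eq_sym => /unlift_some[l il _]; rewrite il !hX !ffunE -il.
have : q i != q j by rewrite (inj_eq perm_inj) -val_eqE /=; lia.
rewrite -val_eqE /= => qij; rewrite (_ : (q i < (q j).+1)%N = (q i < q j)%N) ?subrr//; lia.
Qed.

Definition grid_point (R : realFieldType) (m N : nat) (v : {ffun 'I_m -> nat}) : 'rV[R]_m :=
  \row_d (-1 + 2 / N%:R * (v d)%:R).

Lemma grid_point_cube (R : realFieldType) (m N : nat) (v : {ffun 'I_m -> nat}) (d : 'I_m) :
  (v d <= N)%N -> `|grid_point R N v 0 d| <= 1.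
Proof.
case: N => [|N] vN; first by rewrite mxE invr0 mulr0 mul0r addr0 normrN1.
rewrite mxE ler_norml mulrAC lerDl divr_ge0 ?mulr_ge0//=.
rewrite -lerBrDl opprK ler_pdivrMr ?ltr0n// ler_wpM2l// ler_nat//.
Qed.

Lemma grid_point_step (R : realFieldType) (m N : nat) (v : {ffun 'I_m -> nat}) (q : 'S_m)
    (i : nat) (d : 'I_m) :
  `|grid_point R N (kuhn_vertex v q i) 0 d - grid_point R N (kuhn_vertex v q 0) 0 d| <= 2 / N%:R.
Proof.
rewrite !mxE !ffunE ltn0 addn0 natrD.
rewrite (_ : _ - _ = 2 / N%:R * (q d < i)%N%:R); last by ring.
case: (_ < _)%N; rewrite ?mulr1 ?mulr0 ?normr0 ?divr_ge0//.
by rewrite ger0_norm ?divr_ge0.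
Qed.

(** The map [h] given by [(X, U)] and the map [g], which interpolates linearly between height 0 and
    the graph of [f], agree on the boundary of the grid, so their volume sums coincide. The sum of
    [h] is O(1/N) by the contact estimate; that of [g] has nonnegative terms and stays bounded below
    because of the cubes over which [f >= c]. *)
Lemma contact_obstruction (R : realType) (n : nat) (X : 'rV[R]_n.+1 -> 'rV[R]_n)
    (U : 'rV[R]_n.+1 -> R) (P : 'rV[R]_n.+1 -> 'rV[R]_n) (f : 'rV[R]_n -> R) (C r c : R) :
  0 < C -> 0 < r -> 0 < c ->
  (forall (w w' : 'rV[R]_n.+1) (e : R), 0 < e <= 1 ->
     (forall d, `|w 0 d| <= 1) -> (forall d, `|w' 0 d| <= 1) ->
     (forall d, `|w' 0 d - w 0 d| <= e) ->
     (forall j, `|X w' 0 j - X w 0 j| <= C * e) /\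
     `|U w' - U w - \sum_(j < n) P w 0 j * (X w' 0 j - X w 0 j)| <= C * e ^+ 2) ->
  (forall w : 'rV[R]_n.+1, (forall d, `|w 0 d| <= 1) -> (exists d, `|w 0 d| = 1) ->
     (forall j, X w 0 j = w 0 (lift ord_max j)) /\
     U w = (1 + w 0 ord_max) / 2 * f (col' ord_max w)) ->
  (forall y, 0 <= f y) -> (forall y : 'rV[R]_n, (forall j, `|y 0 j| <= r) -> c <= f y) -> False.
Proof.
move=> C0 r0 c0 Hc Hb f0 fc.
(* Since [1/K <= r] and [N = 2 K M], the [M] consecutive indices from [K M] on give coordinates in
   [[0, 1/K]], where [f] is at least [c]. *)
pose K := (Num.truncn r^-1).+1.
have Kr : K%:R^-1 <= r.
  rewrite -[leRHS]invrK lef_pV2 ?posrE ?invr_gt0 ?ltr0n//.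
  by rewrite ltW// truncnS_gt.
(* After division by the common factor [(n+1)! 2^n / N], the lower bound is [M c / (2 K)^n] and the
   upper bound is [(n+1)! 8 C^(n+1)]; [D < M c] makes them contradictory. *)
pose D : R := (n.+1)`!%:R * 8 * C ^+ n.+1 * (2 * K%:R) ^+ n.
pose M := (Num.truncn (D / c)).+1.
have MD : D < M%:R * c by rewrite -ltr_pdivrMr// truncnS_gt.
pose N := (2 * K * M)%N.
have N0 : (0 < N)%N by [].
have NR0 : 0 < N%:R :> R by rewrite ltr0n.
have eN : 0 < (2 / N%:R : R) <= 1.
  apply/andP; split; first exact: divr_gt0.
  rewrite ler_pdivrMr// mul1r ler_nat /N; lia.
pose h (v : {ffun 'I_n.+1 -> nat}) : 'rV[R]_n.+1 := \row_d
  (if unlift ord_max d is Some j then X (grid_point R N v) 0 j else U (grid_point R N v)).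
pose g (v : {ffun 'I_n.+1 -> nat}) : 'rV[R]_n.+1 := \row_d
  (if unlift ord_max d is Some j then grid_point R N v 0 (lift ord_max j)
   else (1 + grid_point R N v 0 ord_max) / 2 * f (col' ord_max (grid_point R N v))).
have gh : \sum_(v : {ffun 'I_n.+1 -> 'I_N}) \sum_(q : 'S_n.+1)
     (-1) ^+ q * simplex_det g (nat_vertex v) q =
  \sum_(v : {ffun 'I_n.+1 -> 'I_N}) \sum_(q : 'S_n.+1)
     (-1) ^+ q * simplex_det h (nat_vertex v) q.
  apply: discrete_Stokes => v vN [d vd]; apply/rowP => l; rewrite !mxE.
  have [XE UE] : (forall j, X (grid_point R N v) 0 j = grid_point R N v 0 (lift ord_max j)) /\
     U (grid_point R N v) = (1 + grid_point R N v 0 ord_max) / 2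
        * f (col' ord_max (grid_point R N v)).
    apply: Hb; first by move=> e; apply: grid_point_cube.
    exists d; rewrite mxE; case/orP: vd => /eqP ->; first by rewrite mulr0 addr0 normrN1.
    by rewrite divfK ?gt_eqF// (_ : -1 + 2 = 1 :> R) ?normr1//; ring.
  by case: unliftP => [j _|_]; rewrite ?XE ?UE ?mxE.
have gE v (q : 'S_n.+1) : (-1) ^+ q * simplex_det g v q = (2 / N%:R) ^+ n * (N%:R^-1 *
    f (col' ord_max (grid_point R N (kuhn_vertex v q (q ord_max))))).
  rewrite (@simplex_det_graph _ _ (-1) (2 / N%:R)); last first.
    by move=> w j; rewrite mxE liftK mxE.
  congr (_ * _); rewrite !mxE unlift_none.
  have -> : col' ord_max (grid_point R N (kuhn_vertex v q (q ord_max).+1)) =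
            col' ord_max (grid_point R N (kuhn_vertex v q (q ord_max))).
    apply/rowP => j; rewrite !mxE !ffunE; congr (_ + _ * (_ + nat_of_bool _)%:R).
    have : q (lift ord_max j) != q ord_max.
      by rewrite (inj_eq perm_inj) eq_sym neq_lift.
    rewrite -val_eqE /=; lia.
  rewrite -mulrBl; congr (_ * _); rewrite !ffunE ltnSn ltnn !natrD /=.
  field; exact: lt0r_neq0.
have hB (v : {ffun 'I_n.+1 -> nat}) (q : 'S_n.+1) : (forall d, v d < N)%N ->
    `|(-1) ^+ q * simplex_det h v q| <=
    (n.+1)`!%:R * (C * (2 / N%:R)) ^+ n * (2 * (C * (2 / N%:R) ^+ 2)).
  move=> vN; rewrite normrM normrX normrN1 expr1n mul1r.
  have cube i d : `|grid_point R N (kuhn_vertex v q i) 0 d| <= 1.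
    apply: grid_point_cube; rewrite ffunE; case: (q d < i)%N; have := vN d; lia.
  apply: (@norm_det_le _ _ _ (fun j => P (grid_point R N (kuhn_vertex v q 0)) 0 j)).
  - by apply: mulr_ge0; [exact: ltW|exact: divr_ge0].
  - by apply: mulr_ge0 => //; apply: mulr_ge0; [exact: ltW|exact: exprn_even_ge0].
  - move=> i j; rewrite !mxE liftK.
    suff /(Hc _ _ _ eN (cube i) (cube i.+1))[+ _] : forall d, `|grid_point R N (kuhn_vertex v q i.+1) 0 d
      - grid_point R N (kuhn_vertex v q i) 0 d| <= 2 / N%:R by apply.
    move=> d.
    rewrite !mxE !ffunE !natrD.
    rewrite (_ : _ - _ = 2 / N%:R * ((q d < i.+1)%N%:R - (q d < i)%N%:R)); last by ring.
    rewrite normrM (ger0_norm (divr_ge0 _ _))// ler_piMr ?divr_ge0//.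
    rewrite ltnS leq_eqVlt; case: eqP => [->|_] /=; first by rewrite ltnn subr0 normr1.
    by rewrite subrr normr0.
  (* All rows must share the coefficients [P], so both ends of an edge are compared with the first
     vertex of the simplex; this costs the factor 2. *)
  - move=> i.
    have H l := (Hc _ _ _ eN (cube 0) (cube l) (fun d => grid_point_step R N v q l d)).2.
    pose a l := U (grid_point R N (kuhn_vertex v q l)) - U (grid_point R N (kuhn_vertex v q 0))
      - \sum_(j < n) P (grid_point R N (kuhn_vertex v q 0)) 0 j *
         (X (grid_point R N (kuhn_vertex v q l)) 0 j - X (grid_point R N (kuhn_vertex v q 0)) 0 j).
    rewrite (_ : _ - _ = a i.+1 - a i); last first.
      rewrite (eq_bigr (fun j => P (grid_point R N (kuhn_vertex v q 0)) 0 j *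
          (X (grid_point R N (kuhn_vertex v q i.+1)) 0 j
           - X (grid_point R N (kuhn_vertex v q 0)) 0 j)
        - P (grid_point R N (kuhn_vertex v q 0)) 0 j *
          (X (grid_point R N (kuhn_vertex v q i)) 0 j
           - X (grid_point R N (kuhn_vertex v q 0)) 0 j))); last first.
        by move=> j _; rewrite !mxE liftK; ring.
      by rewrite sumrB !mxE unlift_none /a; ring.
    rewrite mulr_natl mulr2n; apply: le_trans (ler_normB _ _) _.
    by apply: lerD; exact: H.
have cst (T : finType) (x : R) : #|T|%:R * x = \sum_(t : T) x.
  by rewrite sumr_const mulr_natl.
have lower : (M ^ n.+1 * (n.+1)`!)%:R * ((2 / N%:R) ^+ n * (N%:R^-1 * c)) <=
   \sum_(v : {ffun 'I_n.+1 -> 'I_N}) \sum_(q : 'S_n.+1)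
     (-1) ^+ q * simplex_det g (nat_vertex v) q.
  have uN (u : 'I_M) : (K * M + u < N)%N by have := ltn_ord u; rewrite /N; lia.
  pose i (u : {ffun 'I_n.+1 -> 'I_M}) : {ffun 'I_n.+1 -> 'I_N} := [ffun d => Ordinal (uN (u d))].
  have iI : injective i.
    move=> u w /ffunP uw; apply/ffunP => d; apply/val_inj/eqP.
    by have := congr1 val (uw d); rewrite !ffunE /= => /addnI ->.
  rewrite (bigID (mem [set i u | u in [set: {ffun 'I_n.+1 -> 'I_M}]])) /=.
  rewrite -[leLHS]addr0 lerD//; last first.
    do 2![apply: sumr_ge0 => ? _]; rewrite gE.
    by rewrite mulr_ge0 ?exprn_ge0 ?divr_ge0// mulr_ge0 ?invr_ge0// ltW.
  rewrite big_imset /=; last by move=> ? ? _ _ /iI.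
  have cM : #|{ffun 'I_n.+1 -> 'I_M}| = (M ^ n.+1)%N by rewrite card_ffun !card_ord.
  rewrite natrM -cM.
  rewrite -card_Sn -mulrA cst [leRHS](eq_bigl predT); last by move=> u; rewrite finset.in_setT.
  apply: ler_sum => u _; rewrite cst.
  apply: ler_sum => q _; rewrite gE ler_wpM2l ?exprn_ge0 ?divr_ge0//.
  rewrite ler_wpM2l ?invr_ge0//; apply: fc => j.
  apply: le_trans Kr; rewrite !mxE !ffunE /=.
  set b := nat_of_bool _; have b1 : (b <= 1)%N by rewrite /b; case: (_ < _)%N.
  rewrite (_ : _ + _ = (u (lift ord_max j) + b)%N%:R / (K * M)%N%:R); last first.
    by rewrite /N !natrD !natrM; field; rewrite !pnatr_eq0.
  rewrite ger0_norm ?divr_ge0// natrM invfM mulrCA ler_piMr ?invr_ge0//.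
  rewrite ler_pdivrMr ?ltr0n// mul1r ler_nat; have := ltn_ord (u (lift ord_max j)); lia.
have upper : \sum_(v : {ffun 'I_n.+1 -> 'I_N}) \sum_(q : 'S_n.+1)
     (-1) ^+ q * simplex_det h (nat_vertex v) q <=
   (N ^ n.+1 * (n.+1)`!)%:R *
    ((n.+1)`!%:R * (C * (2 / N%:R)) ^+ n * (2 * (C * (2 / N%:R) ^+ 2))).
  have cN : #|{ffun 'I_n.+1 -> 'I_N}| = (N ^ n.+1)%N by rewrite card_ffun !card_ord.
  rewrite natrM -cN.
  rewrite -[X in _ * X%:R * _]card_Sn -mulrA cst; apply: ler_sum => v _.
  rewrite cst; apply: ler_sum => q _; apply: le_trans (ler_norm _) _; apply: hB => d.
  by rewrite ffunE.
have := le_trans lower; rewrite gh => /(_ _ upper).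
have F0 : 0 < (n.+1)`!%:R :> R by rewrite ltr0n fact_gt0.
have M0 : 0 < M%:R :> R by rewrite ltr0n.
have K0 : 0 < K%:R :> R by rewrite ltr0n.
rewrite leNgt => /negP; apply.
rewrite (natrM _ (N ^ _)) (natrM _ (M ^ _)) !natrX.
have NE : N%:R = 2 * K%:R * M%:R :> R by rewrite /N !natrM.
have -> : M%:R ^+ n.+1 * (n.+1)`!%:R * ((2 / N%:R) ^+ n * (N%:R^-1 * c)) =
    (n.+1)`!%:R * 2 ^+ n / N%:R * (M%:R * c / (2 * K%:R) ^+ n).
  rewrite NE !exprMn !exprVn !exprMn !exprS; field.
  by rewrite !expf_neq0 ?lt0r_neq0// addr_eq0.
have -> : N%:R ^+ n.+1 * (n.+1)`!%:R *
    ((n.+1)`!%:R * (C * (2 / N%:R)) ^+ n * (2 * (C * (2 / N%:R) ^+ 2))) =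
    (n.+1)`!%:R * 2 ^+ n / N%:R * ((n.+1)`!%:R * 8 * C ^+ n.+1).
  rewrite !exprMn !exprVn !exprS; field.
  by rewrite expf_neq0 ?lt0r_neq0.
have P0 : 0 < (n.+1)`!%:R * 2 ^+ n / N%:R :> R by rewrite divr_gt0 ?mulr_gt0 ?exprn_gt0.
rewrite ltr_pM2l// ltr_pdivlMr//.
by rewrite exprn_gt0// mulr_gt0.
Qed.

Local Open Scope classical_set_scope.
Local Open Scope ring_scope.

(** * Growth of absolutely continuous functions *)

Lemma derivable_expansion (R : realType) (f : R -> R) (c e : R) :
  derivable f c 1 -> 0 < e -> exists2 r, 0 < r &
    forall t, `|t - c| < r -> `|f t - f c - derive1 f c * (t - c)| <= e * `|t - c|.
Proof.
move=> df e0; have := df; rewrite /derivable => /cvgrPdist_lt/(_ _ e0).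
rewrite derive1E => -[r /= r0 H]; exists r => // t tr.
have [->|tc] := eqVneq t c; first by rewrite !subrr mulr0 subr0 normr0 mulr0.
have tc0 : t - c != 0 by rewrite subr_eq0.
have := H (t - c); rewrite /= sub0r normrN => /(_ tr tc0).
have -> : (t - c)%:A = t - c :> R by rewrite /GRing.scale /= mulr1.
rewrite subrK -/(derive f c 1) => /ltW.
rewrite -(ler_pM2r (_ : 0 < `|t - c|)) ?normr_gt0// -normrM mulrBl.
by rewrite /GRing.scale /= mulrAC mulVf// mul1r [X in X <= _ -> _]distrC.
Qed.

(** Continuous induction, run at the supremum of the points satisfying [Q]. The step passes from a
    point left of [c] to a point right of [c], which is the kind of increment that a derivative at
    [c] controls. *)
Lemma interval_chain (R : realType) (a b : R) (Q : R -> Prop) :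
  a <= b -> Q a ->
  (forall c, a <= c <= b -> exists2 r, 0 < r & forall s t, a <= s <= c -> c <= t <= b ->
     c - r < s -> t < c + r -> Q s -> Q t) -> Q b.
Proof.
move=> ab Qa step.
pose S := [set t | a <= t <= b /\ Q t].
have Sa : S a by rewrite /S /= lexx ab.
have supS : has_sup S by split; [exists a|exists b => t [/andP[]]].
set c := sup S.
have ac : a <= c by apply: ub_le_sup => //; case: supS.
have cb : c <= b by apply: ge_sup; [exists a|move=> t [/andP[]]].
have [|r r0 H] := step c; first by rewrite ac.
have [s [/andP[as_ sb] Qs] cs] := sup_adherent r0 supS.
have sc : s <= c by apply: ub_le_sup; [case: supS|rewrite /S /= as_ sb].
have [bc|cb'] := ltP b (c + r).
  by apply: (H s b) => //; rewrite ?as_ ?cb ?lexx.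
have Q2 : Q (c + r / 2) by apply: (H s) => //; try (apply/andP; split => //); lra.
have : c + r / 2 <= c.
  apply: ub_le_sup; first by case: supS.
  by split => //; apply/andP; split; lra.
lra.
Qed.

Lemma negligible_open_cover (R : realType) (N : set R) (e : R) :
  (@lebesgue_measure R).-negligible N -> 0 < e ->
  exists O : set R, [/\ open O, N `<=` O & (lebesgue_measure O < e%:E)%E].
Proof.
move=> [A [mA A0 NA]] e0.
have [|O [oO AO Oe]] := @lebesgue_regularity_outer R A e mA _ e0.
  by rewrite [X in (X < _)%E](A0 : _ = _) ltry.
exists O; split => //; first exact: subset_trans NA AO.
rewrite -(setDUK AO); apply: le_lt_trans (measureU2 _ _ _) _ => //.
  by apply: measurableD => //; exact: measurable_realfun.open_measurable.
by rewrite [X in (X + _)%E]A0 add0e.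
Qed.

Lemma sum_length_le (R : realType) (O : set R) (m : nat) (s t : 'I_m -> R) :
  measurable O -> (forall i, s i <= t i) -> (forall i, `]s i, t i[ `<=` O) ->
  trivIset setT (fun i => `]s i, t i[%classic) ->
  ((\sum_(i < m) (t i - s i))%:E <= lebesgue_measure O)%E.
Proof.
move=> mO st sO tr.
rewrite -sumEFin (eq_bigr (fun i => lebesgue_measure `]s i, t i[%classic)); last first.
  move=> i _; rewrite lebesgue_measure_itv /= lte_fin.
  case: ltP => [_|ts]; first by rewrite EFinB.
  have -> : t i = s i by apply/eqP; rewrite eq_le ts st.
  by rewrite subrr.
rewrite -measure_bigsetU_ord//; apply: le_measure; rewrite ?inE//.
  exact: bigsetU_measurable.
by elim/big_ind : _ => [|A B AO BO|i _]; [exact: sub0set|rewrite subUset|exact: sO].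
Qed.

Lemma derivable_local_growth (R : realType) (f H : R -> R) (M c e : R) :
  0 <= M -> 0 < e -> derivable f c 1 -> derivable H c 1 ->
  `|derive1 f c| <= M * derive1 H c ->
  exists2 r, 0 < r & forall s t, c - r < s -> s <= c -> c <= t -> t < c + r ->
    `|f t - f s| <= M * (H t - H s) + e * (t - s).
Proof.
move=> M0 e0 df dH fH.
have M1 : 0 < M + 1 by lra.
have [r1 r10 F] := derivable_expansion df (divr_gt0 e0 (ltr0n R 2 : 0 < 2)).
(* The error for [H] is later multiplied by [M]; dividing by [M + 1] keeps the product below [e / 2]
   also when [M = 0]. *)
have [|r2 r20 G] := @derivable_expansion _ _ _ (e / 2 / (M + 1)) dH.
  by rewrite !divr_gt0.
exists (Num.min r1 r2); first by rewrite lt_min r10.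
move=> s t cs sc ct tc.
have [rs1 rs2] : r1 >= Num.min r1 r2 /\ r2 >= Num.min r1 r2.
  by rewrite !ge_min !lexx orbT.
have ns : `|s - c| = c - s by rewrite ler0_norm ?opprB// subr_le0.
have nt : `|t - c| = t - c by rewrite ger0_norm// subr_ge0.
have Fs : `|s - c| < r1 by rewrite ns; lra.
have Ft : `|t - c| < r1 by rewrite nt; lra.
have Gs : `|s - c| < r2 by rewrite ns; lra.
have Gt : `|t - c| < r2 by rewrite nt; lra.
have := F _ Fs; have := F _ Ft; have := G _ Gs; have := G _ Gt.
rewrite ns nt !ler_norml => /andP[G1 _] /andP[_ G2] /andP[F1 F2] /andP[F3 F4].
have K : M * (e / 2 / (M + 1)) <= e / 2.
  rewrite mulrCA ler_piMr//; first by lra.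
  by rewrite ler_pdivrMr//; lra.
set k := e / 2 / (M + 1) in K G1 G2.
have G3 : M * (H t - H s) >= M * (derive1 H c * (t - s) - k * (t - s)).
  by apply: ler_wpM2l => //; lra.
have K2 : (t - s) * (M * k) <= (t - s) * (e / 2).
  by apply: ler_wpM2l => //; lra.
have K3 : `|derive1 f c| * (t - s) <= M * derive1 H c * (t - s).
  by apply: ler_wpM2r => //; lra.
have := ler_norm (derive1 f c * (t - s)); have := ler_norm (- (derive1 f c * (t - s))).
rewrite normrN normrM (ger0_norm (_ : 0 <= t - s)); last by lra.
move=> N1 N2.
by apply/andP; split; lra.
Qed.

(* The exceptional null set is covered by an open set so small that the variation of [f]
   on it is at most [e]; elsewhere the derivatives control the increments. *)
Lemma ac_growth (R : realType) (a b M : R) (f H : R -> R) :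
  a <= b -> 0 <= M -> abs_continuous (fun x y : R => `|x - y|) a b f ->
  (forall s t, a <= s -> s <= t -> t <= b -> H s <= H t) ->
  {ae @lebesgue_measure R, forall t, a < t < b ->
     [/\ derivable f t 1, derivable H t 1 & `|derive1 f t| <= M * derive1 H t]} ->
  `|f b - f a| <= M * (H b - H a).
Proof.
move=> ab M0 acf Hmono aeN; apply/ler_addgt0Pr => eps eps0.
have ba0 : 0 <= b - a by lra.
(* The error [eps] splits into [e * (b - a)] for the slopes and [e] for the variation over the
   exceptional intervals. *)
pose e := eps / (b - a + 1).
have e0 : 0 < e by rewrite divr_gt0//; lra.
have eE : e * (b - a) + e = eps by rewrite /e; field; lra.
have [d d0 acd] := acf _ e0.
pose N := ~` [set t | a < t < b ->
  [/\ derivable f t 1, derivable H t 1 & `|derive1 f t| <= M * derive1 H t]].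
(* The endpoints join the null set because the hypothesis on derivatives concerns the open interval
   only. *)
have negN : (@lebesgue_measure R).-negligible (N `|` [set a; b]).
  apply: negligibleU; first exact: aeN.
  by apply: negligibleU; (apply/negligibleP; last exact: lebesgue_measure_set1);
    exact: measurable_set1.
have [V [oO NO Od]] := negligible_open_cover negN d0.
(* The invariant of the induction: the growth bound up to the variation of [f] over finitely many
   disjoint intervals inside [V], collected on the way to [t]. *)
pose Q t := a <= t <= b /\ exists m (s u : 'I_m -> R),
  [/\ forall i, [/\ a <= s i, s i <= u i & u i <= t],
     forall i, `]s i, u i[ `<=` V,
     trivIset setT (fun i => `]s i, u i[%classic) &
     `|f t - f a| <= M * (H t - H a) + e * (t - a) + \sum_(i < m) `|f (s i) - f (u i)| ].
suff [_ [m [s [u [su suO dsj fs]]]]] : Q b.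
  apply: le_trans fs _; rewrite -addrA lerD2l -eE lerD2l ltW//.
  apply: acd => //.
  have /le_lt_trans /(_ Od) : ((\sum_(i < m) (u i - s i))%:E <= lebesgue_measure V)%E.
    by apply: sum_length_le => //; [exact: measurable_realfun.open_measurable|
       move=> i; have [] := su i].
  by rewrite lte_fin.
apply: (@interval_chain R a b Q) => //.
  split; first by rewrite lexx.
  exists 0%N, (fun=> 0), (fun=> 0); split => //; try by move=> [].
  by rewrite !subrr !mulr0 big_ord0 normr0 !addr0.
move=> c /andP[ac cb].
have extend s t : a <= s <= t -> t <= b -> Q s ->
    `|f t - f s| <= M * (H t - H s) + e * (t - s) -> Q t.
  move=> /andP[as_ st] tb [sab [m [x [y [xy xyO dsj fs]]]]] fst.
  split; first by rewrite (le_trans as_ st).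
  exists m, x, y; split => //.
    by move=> i; have [? ? ?] := xy i; split => //; exact: le_trans st.
  have := ler_normD (f t - f s) (f s - f a).
  rewrite (_ : f t - f s + (f s - f a) = f t - f a); last by ring.
  move: (\sum_(i < m) _) fs => S fs; lra.
have [Oc|nOc] := pselect (V c).
  have [r /= r0 rO] : exists2 r, 0 < r & forall x, `|c - x| < r -> V x.
    by have [r r0 H0] := open_nbhs_nbhs (conj oO Oc); exists r.
  exists r => // s t /andP[as_ sc] /andP[ct tb] cs tc.
  move=> [sab [m [x [y [xy xyO dsj fs]]]]].
  split; first by rewrite (le_trans as_ (le_trans sc ct)).
  exists m.+1, (fun i => if unlift ord_max i is Some j then x j else s),
     (fun i => if unlift ord_max i is Some j then y j else t); split.
  - move=> i; case: unliftP => [j _|_]; last by split => //; exact: le_trans ct.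
    by have [? ? ?] := xy j; split => //; apply: le_trans (le_trans sc ct).
  - move=> i; case: unliftP => [j _|_]; first exact: xyO.
    move=> z /=; rewrite in_itv /= => /andP[sz zt]; apply: rO.
    by rewrite ltr_norml; apply/andP; split; lra.
  - apply/trivIsetP => i j _ _ ij.
    have disj k z : `]x k, y k[%classic z -> `]s, t[%classic z -> False.
      rewrite /= !in_itv /= => /andP[_ zy] /andP[sz _]; have [_ _ ?] := xy k; lra.
    rewrite -subset0 => z [].
    case: (unliftP ord_max i) ij => [k ->|->]; case: (unliftP ord_max j) => [l ->|->] kl.
    + have /trivIsetP/(_ k l I I) := dsj.
      by rewrite -subset0 => D0 zk zl; apply: D0 => //; apply: contraNneq kl => ->.
    + by move=> zk zs; case: (disj _ _ zk zs).
    + by move=> zk zs; case: (disj _ _ zs zk).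
    + by rewrite eqxx in kl.
  - rewrite (bigD1_ord ord_max)//= unlift_none.
    rewrite [X in _ <= _ + (_ + X)](eq_bigr (fun i => `|f (x i) - f (y i)|)); last first.
      by move=> i _; rewrite liftK.
    have := ler_normD (f t - f s) (f s - f a).
    rewrite (_ : f t - f s + (f s - f a) = f t - f a); last by ring.
    have : M * (H s - H a) <= M * (H t - H a).
      by apply: ler_wpM2l => //; rewrite lerD2r; apply: Hmono => //; exact: le_trans ct.
    have : e * (s - a) <= e * (t - a).
      by apply: ler_wpM2l; [exact: ltW|rewrite lerD2r (le_trans sc)].
    rewrite (distrC (f s) (f t)).
    by move: (\sum_(i < m) _) fs => S fs; lra.
have acb : a < c < b.
  rewrite !lt_neqAle ac cb !andbT; apply/andP; split.
    by apply/eqP => e1; apply: nOc; apply: NO; right; left.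
  by apply/eqP => e1; apply: nOc; apply: NO; right; right.
have [df dH fH] : [/\ derivable f c 1, derivable H c 1 & `|derive1 f c| <= M * derive1 H c].
  by apply: contrapT => h; apply: nOc; apply: NO; left => /(_ acb).
have [r r0 F] := derivable_local_growth M0 e0 df dH fH.
exists r => // s t /andP[as_ sc] /andP[ct tb] cs tc Qs.
apply: extend Qs _ => //; first by rewrite as_ (le_trans sc).
exact: F.
Qed.

Lemma abs_continuous_comp (R : realType) (S T : Type) (d : S -> S -> R) (d' : T -> T -> R)
    (p : S -> T) (K a b : R) (g : R -> S) :
  0 < K -> (forall x y, d' (p x) (p y) <= K * d x y) ->
  abs_continuous d a b g -> abs_continuous d' a b (p \o g).
Proof.
move=> K0 pd ac e e0; have [r r0 H] := ac (e / K) (divr_gt0 e0 K0); exists r => // m s t st tr sr.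
have := H m s t st tr sr; rewrite ltr_pdivlMr// mulrC mulr_sumr; apply: le_lt_trans.
by apply: ler_sum => i _; exact: pd.
Qed.

Lemma abs_continuous_sub (R : realType) (T : Type) (d : T -> T -> R) (a b c e : R)
    (g : R -> T) :
  a <= c -> e <= b -> abs_continuous d a b g -> abs_continuous d c e g.
Proof.
move=> ac eb H x x0; have [r r0 K] := H x x0; exists r => // m s t st; apply: K => i.
by have [h1 h2 h3] := st i; split => //; [exact: le_trans h1|exact: le_trans eb].
Qed.

(** The witness is the upper limit of the difference quotients of step [1/(n+1)], which are
    measurable because the extended function is continuous; at a point of differentiability they
    converge to the derivative. *)
Lemma measurable_derivative (R : realType) (a b : R) (F : R -> R) :
  a < b -> abs_continuous (fun x y : R => `|x - y|) a b F ->
  exists2 dF : R -> R, measurable_fun setT dF &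
    forall t, a < t < b -> derivable F t 1 -> dF t = derive1 F t.
Proof.
move=> ab acF.
(* [F \o c] is a continuous extension of [F] outside [a, b]. *)
pose c t := Num.max a (Num.min t b).
have cab t : a <= c t <= b by rewrite le_max lexx /= ge_max (ltW ab) ge_min lexx orbT.
have cid t : a <= t <= b -> c t = t by move=> /andP[h1 h2]; rewrite /c (min_idPl h2) (max_idPr h1).
have cmono s t : s <= t -> 0 <= c t - c s <= t - s.
  move=> st; rewrite /c !maxEle !minEle.
  by do ! case: ifPn => /=; rewrite -?ltNge => *; apply/andP; split; lra.
have contF : continuous (F \o c).
  move=> t; apply/cvgrPdist_lt => e e0.
  have [d d0 H] := acF e e0.
  have step s u : s <= u -> u - s < d -> `|F (c s) - F (c u)| < e.
    move=> su us; have /andP[h1 h2] := cmono _ _ su.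
    have := H 1%N (fun=> c s) (fun=> c u); rewrite !big_ord1; apply.
    - by move=> _; have /andP[? _] := cab s; have /andP[_ ?] := cab u; split => //; lra.
    - by apply/trivIsetP => i j _ _; rewrite !ord1.
    - lra.
  near=> s; rewrite /=.
  have : `|t - s| < d by near: s; exact: cvgr_dist_lt.
  rewrite ltr_norml => /andP[h1 h2].
  case: (leP s t) => st; first by rewrite distrC; apply: step => //; lra.
  by apply: step; [exact: ltW|lra].
pose D n t : R := n.+1%:R * ((F \o c) (t + n.+1%:R^-1) - (F \o c) t).
have mFc : measurable_fun setT (F \o c) by exact: measurable_realfun.continuous_measurable_fun.
have mD n : measurable_fun setT (D n).
  apply: measurable_funM; first exact: measurable_cst.
  apply: measurable_funB => //.
  apply: (measurableT_comp mFc).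
  by apply: measurable_funD; [exact: measurable_id|exact: measurable_cst].
exists (fun t => fine (limn_esup (fun n => (D n t)%:E))).
  apply: measurableT_comp => //.
  by apply: measurable_fun_limn_esup => n; apply/measurable_EFinP.
move=> t /andP[at_ tb] dF.
suff DF : (D n t)%:E @[n --> \oo] --> (derive1 F t)%:E.
  by rewrite is_cvg_limn_esupE ?(cvg_lim _ DF)//; apply/cvg_ex; exists (derive1 F t)%:E.
apply: cvg_EFin; first by near=> n.
apply/cvgrPdist_le => e e0.
have [r r0 H] := derivable_expansion dF e0.
have m0 : 0 < Num.min r (b - t) by rewrite lt_min r0 subr_gt0.
near=> n; rewrite /=.
have n0 : 0 < n.+1%:R^-1 :> R by rewrite invr_gt0.
have nr : n.+1%:R^-1 < Num.min r (b - t).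
  by near: n; exact: (near_infty_natSinv_lt (PosNum m0)).
move: nr; rewrite lt_min => /andP[nr nb].
have := H (t + n.+1%:R^-1); rewrite addrAC subrr add0r (gtr0_norm n0) => /(_ nr).
have c1 : a <= t + n.+1%:R^-1 <= b.
  by move: n0 nb; set k := n.+1%:R^-1 => *; apply/andP; split; lra.
rewrite /D /= !cid//; last by rewrite !ltW.
set d := F _ - F t => h.
rewrite (_ : _ - _ = - (n.+1%:R * (d - derive1 F t * n.+1%:R^-1))); last first.
  by field; rewrite ?natr1 ?nat1r pnatr_eq0.
by rewrite normrN normrM ger0_norm// mulrC -ler_pdivlMr.
Unshelve. all: by end_near. Qed.

(** * Horizontal paths *)

Lemma frame_comb_low (R : realType) (n k : nat) (p : jet R n k)
    (c : {ffun frame_idx n k -> R}) (I : midx n k) :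
  (mdeg (bmnm I) < k)%N ->
  (frame_comb p c).2 I = \sum_(j < n) c (inl j) * p.2 (midx_succ I j).
Proof.
move=> Ik.
have sum2 (J : finType) (P : pred J) (F : J -> jet R n k) (K : midx n k) :
    (\sum_(i | P i) F i).2 K = \sum_(i | P i) (F i).2 K.
  by apply: (big_morph (fun v : jet R n k => v.2 K)) => [x y|]; rewrite ffunE.
have Z2 a (v : jet R n k) K : (a *: v).2 K = a * v.2 K by exact: ffunE.
have U2 (L K : midx n k) : (ddu R L).2 K = (K == L)%:R by exact: ffunE.
have vert : \sum_(J : {I : midx n k | mdeg (bmnm I) == k})
    (c (inr J) *: frame p (inr J)).2 I = 0.
  apply: big1 => J _; rewrite Z2 U2; case: eqVneq => [IJ|_]; last by rewrite mulr0.
  by move: Ik; rewrite IJ (eqP (valP J)) ltnn.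
rewrite /frame_comb sum2 big_sumType vert; apply: etrans (addr0 _) _.
apply: eq_bigr => j _; rewrite Z2 /Xfield [X in _ * X]ffunE sum2 ffunE add0r.
rewrite (bigD1 I)// Z2 U2 eqxx mulr1 big1 => [|L /andP[_ LI]]; first by rewrite /= addr0.
by rewrite Z2 U2 eq_sym (negbTE LI) mulr0.
Qed.

(** The frame coefficients of a horizontal vector are its base components and its fiber components
    of order [k]; the lower orders do not count in the norm. *)
Lemma hnormE (R : realType) (n k : nat) (p v : jet R n k) : horizontal p v ->
  hnorm p v = Num.sqrt (\sum_(j < n) v.1 0 j ^+ 2
    + \sum_(J : {I : midx n k | mdeg (bmnm I) == k}) v.2 (val J) ^+ 2).
Proof.
move=> [c vc]; rewrite /hnorm.
set S := [set d | v = frame_comb p d].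
have Sc : S c by [].
have -> : xget 0 S = c.
  apply: (@frame_comb_inj _ _ _ p); rewrite -vc; symmetry.
  exact: (xgetPex 0 (ex_intro S c Sc)).
rewrite big_sumType /=; congr (Num.sqrt (_ + _)); apply: eq_bigr => i _.
  by rewrite vc frame_comb_fst.
by rewrite vc frame_comb_snd.
Qed.

Lemma hnorm_ge0 (R : realType) (n k : nat) (p v : jet R n k) : 0 <= hnorm p v.
Proof. exact: sqrtr_ge0. Qed.

Lemma le_sqrt_sum (R : realType) (J : finType) (F : J -> R) (s : R) (i : J) :
  0 <= s -> `|F i| <= Num.sqrt (\sum_(j : J) F j ^+ 2 + s).
Proof.
move=> s0; rewrite -sqrtr_sqr ler_sqrt; last first.
  by rewrite addr_ge0// sumr_ge0// => j _; exact: sqr_ge0.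
rewrite (bigD1 i)//= -addrA lerDl addr_ge0// sumr_ge0// => j _; exact: sqr_ge0.
Qed.

Lemma velocity_base_le (R : realType) (n k : nat) (p v : jet R n k) (j : 'I_n) :
  horizontal p v -> `|v.1 0 j| <= hnorm p v.
Proof.
move=> /hnormE ->; apply: (@le_sqrt_sum _ _ (fun j => v.1 0 j)).
by apply: sumr_ge0 => J _; exact: sqr_ge0.
Qed.

Lemma velocity_top_le (R : realType) (n k : nat) (p v : jet R n k) (I : midx n k) :
  horizontal p v -> mdeg (bmnm I) = k -> `|v.2 I| <= hnorm p v.
Proof.
move=> /hnormE -> /eqP Ik; rewrite addrC.
apply: (@le_sqrt_sum _ _ (fun J : {I : midx n k | mdeg (bmnm I) == k} => v.2 (val J)) _
  (exist _ I Ik)).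
by apply: sumr_ge0 => J _; exact: sqr_ge0.
Qed.

(** The contact equations [du_I = \sum_j u_(I + e_j) dx_j]. *)
Lemma velocity_low (R : realType) (n k : nat) (p v : jet R n k) (I : midx n k) :
  horizontal p v -> (mdeg (bmnm I) < k)%N ->
  v.2 I = \sum_(j < n) v.1 0 j * p.2 (midx_succ I j).
Proof.
move=> [c ->] Ik; rewrite frame_comb_low//; apply: eq_bigr => j _.
by rewrite frame_comb_fst.
Qed.

Lemma jet_dist_base (R : realType) (n k : nat) (p q : jet R n k) (j : 'I_n) :
  `|p.1 0 j - q.1 0 j| <= jet_dist p q.
Proof.
apply: (@le_sqrt_sum _ _ (fun j => p.1 0 j - q.1 0 j)).
by apply: sumr_ge0 => J _; exact: sqr_ge0.
Qed.

Lemma jet_dist_fiber (R : realType) (n k : nat) (p q : jet R n k) (I : midx n k) :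
  `|p.2 I - q.2 I| <= jet_dist p q.
Proof.
rewrite /jet_dist [X in Num.sqrt X]addrC; apply: (@le_sqrt_sum _ _ (fun I => p.2 I - q.2 I)).
by apply: sumr_ge0 => J _; exact: sqr_ge0.
Qed.

Lemma measurable_fun_sumsq (R : realType) (J : finType) (F : J -> R -> R) :
  (forall j, measurable_fun setT (F j)) ->
  measurable_fun setT (fun t => \sum_(j : J) F j t ^+ 2).
Proof.
by move=> mF; apply: measurable_sum => j; apply: measurable_funX.
Qed.

(* No measurability: the integral of a nonnegative function is a supremum over the
   measurable simple functions below it. *)
Lemma le_ge0_integral d (T : measurableType d) (R : realType)
    (mu : {measure set T -> \bar R}) (D : set T) (f1 f2 : T -> \bar R) :
  (forall x, D x -> (0 <= f1 x)%E) -> (forall x, D x -> (f1 x <= f2 x)%E) ->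
  (\int[mu]_(x in D) f1 x <= \int[mu]_(x in D) f2 x)%E.
Proof.
move=> f10 f12; rewrite !ge0_integralE//; last first.
  by move=> x Dx; apply: le_trans (f12 x Dx); exact: f10.
apply: ereal_sup_le => _ [h /= hf <-]; exists h => //= x; apply: le_trans (hf x) _.
by rewrite !patchE; case: ifPn => // /set_mem; exact: f12.
Qed.

(* The speed agrees almost everywhere with a measurable function, of which [H] is a
   primitive. *)
Lemma speed_primitive (R : realType) (n k : nat) (a b L : R) (g : R -> jet R n k) :
  horizontal_path a b g -> (path_length a b g < L%:E)%E ->
  exists H : R -> R, [/\ {homo H : s t / s <= t}, H b - H a <= L &
    {ae @lebesgue_measure R, forall t, a < t < b ->
      [/\ jet_derivable g t, horizontal (g t) (velocity g t), derivable H t 1 &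
        derive1 H t = hnorm (g t) (velocity g t)]}].
Proof.
move=> [ab acg aeg] gL.
have := ab; rewrite le_eqVlt => /orP[/eqP abE|altb].
  exists (fun=> 0); split => //.
    rewrite subr0 -lee_fin; apply: le_trans (ltW gL).
    by rewrite /path_length; apply: integral_ge0 => t _; rewrite lee_fin hnorm_ge0.
  exists set0; split; [exact: measurable0|exact: measure0|move=> t /=; apply].
  by rewrite abE => /andP[h1 /(lt_trans h1)]; rewrite ltxx.
have /choice[dX HX] : forall j : 'I_n, exists d : R -> R, measurable_fun setT d /\
    forall t, a < t < b -> derivable (fun s => (g s).1 0 j) t 1 ->
      d t = derive1 (fun s => (g s).1 0 j) t.
  move=> j; have [|d ? ?] := @measurable_derivative R a b (fun s => (g s).1 0 j) altb.
    by apply: (@abs_continuous_comp _ _ _ _ _ (fun q : jet R n k => q.1 0 j) 1 _ _ _ _ _ acg) => // x y;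
      rewrite mul1r; exact: jet_dist_base.
  by exists d.
have /choice[dU HU] : forall I : midx n k, exists d : R -> R, measurable_fun setT d /\
    forall t, a < t < b -> derivable (fun s => (g s).2 I) t 1 ->
      d t = derive1 (fun s => (g s).2 I) t.
  move=> I; have [|d ? ?] := @measurable_derivative R a b (fun s => (g s).2 I) altb.
    by apply: (@abs_continuous_comp _ _ _ _ _ (fun q : jet R n k => q.2 I) 1 _ _ _ _ _ acg) => // x y;
      rewrite mul1r; exact: jet_dist_fiber.
  by exists d.
pose h0 t := Num.sqrt (\sum_(j < n) dX j t ^+ 2
    + \sum_(J : {I : midx n k | mdeg (bmnm I) == k}) dU (val J) t ^+ 2).
have mh0 : measurable_fun setT h0.
  apply: measurableT_comp; first exact: measurable_realfun.continuous_measurable_fun (@sqrt_continuous R).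
  apply: measurable_funD; apply: measurable_fun_sumsq => i; first by have [] := HX i.
  by have [] := HU (val i).
have [A [mA A0 NA]] := aeg.
pose B : set R := `]a, b[ `\` A.
have mB : measurable B by apply: measurableD.
have gB t : B t -> [/\ a < t < b, jet_derivable g t & horizontal (g t) (velocity g t)].
  move=> [/= ]; rewrite in_itv /= => tab nA; split => //; apply: contrapT => h.
    by apply: nA; apply: NA => /= /(_ _)[|//]; rewrite in_itv /= !ltW//; case/andP: tab.
  by apply: nA; apply: NA => /= /(_ _)[|//]; rewrite in_itv /= !ltW//; case/andP: tab.
have h0E t : B t -> h0 t = hnorm (g t) (velocity g t).
  move=> /gB[tab [dx du] hv]; rewrite hnormE// /h0; congr (Num.sqrt (_ + _)).
    by apply: eq_bigr => j _; rewrite mxE (HX j).2.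
  by apply: eq_bigr => J _; rewrite ffunE (HU (val J)).2.
(* The cut-off outside [B] makes [h1] at most the speed at every point of [[a, b]], so its integral
   is bounded by the length without measurability of the speed. *)
pose h1 t := h0 t * \1_B t.
have mh1 : measurable_fun setT h1 by apply: measurable_funM => //; exact: measurable_indic.
have h10 t : 0 <= h1 t by rewrite mulr_ge0 ?sqrtr_ge0// indicE.
have h1E t : B t -> h1 t = hnorm (g t) (velocity g t).
  by move=> Bt; rewrite /h1 indicE mem_set// mulr1 h0E.
have h1N t : ~ B t -> h1 t = 0.
  by move=> Bt; rewrite /h1 indicE memNset// mulr0.
have intL : (\int[@lebesgue_measure R]_(t in setT) (h1 t)%:E < L%:E)%E.
  apply: le_lt_trans gL.
  have -> : (\int[@lebesgue_measure R]_(t in setT) (h1 t)%:E =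
             \int[@lebesgue_measure R]_(t in `[a, b]) (h1 t)%:E)%E.
    rewrite [RHS]integral_mkcond; apply: eq_integral => t _.
    rewrite patchE; case: ifPn => // /negP tab; rewrite h1N//= => -[+ _].
    by rewrite /= in_itv /= => /andP[h2 h3]; apply: tab; rewrite inE /= in_itv /= !ltW.
  apply: le_ge0_integral => t _; rewrite lee_fin; first exact: h10.
  have [Bt|nBt] := pselect (B t); first by rewrite h1E.
  by rewrite h1N// hnorm_ge0.
have ih1 : (@lebesgue_measure R).-integrable setT (EFin \o h1).
  apply/integrableP; split; first exact/measurable_EFinP.
  under eq_integral do rewrite /= ger0_norm//.
  by apply: lt_trans intL _; exact: ltry.
have ih y : (@lebesgue_measure R).-integrable `]-oo, y] (EFin \o h1).
  exact: integrableS ih1.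
have lh1 : locally_integrable setT h1 by apply: open_integrable_locally => //; exact: openT.
have fin y : (\int[@lebesgue_measure R]_(t in `]-oo, y]) (h1 t)%:E)%E \is a fin_num.
  exact: integrable_fin_num.
exists (fun x => \int[@lebesgue_measure R]_(t in `]-oo, x]) h1 t); split.
- move=> s t st; rewrite /Rintegral fine_le//.
  apply: ge0_subset_integral => //.
  + by apply/measurable_EFinP; exact: measurable_funTS.
  + by move=> x _; rewrite lee_fin.
  + by move=> x /=; rewrite !in_itv /= => /le_trans; apply.
- apply: (@le_trans _ _ (\int[@lebesgue_measure R]_(t in `]-oo, b]) h1 t)).
    by rewrite gerBl; apply: Rintegral_ge0.
  rewrite -lee_fin /Rintegral fineK//; apply: le_trans (ltW intL).
  apply: ge0_subset_integral => //.
  + by apply/measurable_EFinP.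
  + by move=> x _; rewrite lee_fin.
- have aeA : {ae @lebesgue_measure R, forall t, ~ A t}.
    by exists A; split => // t /=; exact: contrapT.
  have := FTC1Ny ih lh1; apply: filterS2 aeA => t nA [dH HE] tab.
  have Bt : B t by [].
  by have [_ ? ?] := gB t Bt; split => //; rewrite HE h1E.
Qed.

(** * Increments of coordinates along a horizontal path *)

Lemma sum_ord_le (R : realType) (n : nat) (F : 'I_n -> R) (x : R) :
  (forall j, F j <= x) -> \sum_(j < n) F j <= n%:R * x.
Proof.
move=> Fx; apply: (@le_trans _ _ (\sum_(j < n) x)); first exact: ler_sum.
by rewrite sumr_const card_ord mulr_natl.
Qed.

(** [ac_growth] against the primitive of the speed. A general function [p] covers single coordinates
    as well as the contact form with frozen coefficients; its Lipschitz bound makes [p \o g]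
    absolutely continuous. *)
Lemma path_increment (R : realType) (n k : nat) (a b L M K : R) (g : R -> jet R n k)
    (p : jet R n k -> R) (s t : R) :
  horizontal_path a b g -> (path_length a b g < L%:E)%E ->
  0 <= M -> 0 < K -> (forall x y, `|p x - p y| <= K * jet_dist x y) ->
  (forall u, a < u < b -> jet_derivable g u -> horizontal (g u) (velocity g u) ->
     derivable (p \o g) u 1 /\ `|derive1 (p \o g) u| <= M * hnorm (g u) (velocity g u)) ->
  a <= s <= b -> a <= t <= b -> `|p (g t) - p (g s)| <= M * L.
Proof.
move=> hg gL M0 K0 pK dp.
wlog st : s t / s <= t => [hw sab tab|/andP[as_ sb] /andP[at_ tb]].
  by have [st|/ltW st] := leP s t; [|rewrite distrC]; apply: hw.
have [H [Hm HL aeH]] := speed_primitive hg gL.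
have [_ acg _] := hg.
apply: (@le_trans _ _ (M * (H t - H s))); last first.
  apply: ler_wpM2l => //; apply: le_trans HL.
  by apply: lerB; apply: Hm.
apply: (@ac_growth _ s t M (p \o g) H) => //.
- apply: (abs_continuous_sub as_ tb).
  exact: (@abs_continuous_comp _ _ _ _ _ p K _ _ _ _ _ acg).
- by move=> x y _ xy _; exact: Hm.
- case: aeH => N [mN N0 NS]; exists N; split => //.
  apply: subset_trans NS => x /= nh hx; apply: nh => /andP[sx xt].
  have xab : a < x < b by rewrite (le_lt_trans as_ sx) (lt_le_trans xt tb).
  have [jd hv dH HE] := hx xab.
  by have [d1 d2] := dp x xab jd hv; split => //; rewrite HE.
Qed.

Lemma path_base_increment (R : realType) (n k : nat) (a b L : R) (g : R -> jet R n k)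
    (s t : R) (j : 'I_n) :
  horizontal_path a b g -> (path_length a b g < L%:E)%E ->
  a <= s <= b -> a <= t <= b -> `|(g t).1 0 j - (g s).1 0 j| <= L.
Proof.
move=> hg gL sab tab; rewrite -[leRHS]mul1r.
apply: (@path_increment _ _ _ a b L 1 1 g (fun q => q.1 0 j)) => //.
  by move=> x y; rewrite mul1r jet_dist_base.
move=> u _ [du _] hv; split; first exact: du.
by rewrite mul1r; have := velocity_base_le j hv; rewrite mxE.
Qed.

Lemma path_top_increment (R : realType) (n k : nat) (a b L : R) (g : R -> jet R n k)
    (s t : R) (I : midx n k) :
  horizontal_path a b g -> (path_length a b g < L%:E)%E -> mdeg (bmnm I) = k ->
  a <= s <= b -> a <= t <= b -> `|(g t).2 I - (g s).2 I| <= L.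
Proof.
move=> hg gL Ik sab tab; rewrite -[leRHS]mul1r.
apply: (@path_increment _ _ _ a b L 1 1 g (fun q => q.2 I)) => //.
  by move=> x y; rewrite mul1r jet_dist_fiber.
move=> u _ [_ du] hv; split; first exact: du.
by rewrite mul1r; have := velocity_top_le hv Ik; rewrite ffunE.
Qed.

Lemma path_low_increment (R : realType) (n k : nat) (a b L B : R) (g : R -> jet R n k)
    (s t : R) (I : midx n k) :
  horizontal_path a b g -> (path_length a b g < L%:E)%E -> (mdeg (bmnm I) < k)%N ->
  0 <= B -> (forall u j, a <= u <= b -> `|(g u).2 (midx_succ I j)| <= B) ->
  a <= s <= b -> a <= t <= b -> `|(g t).2 I - (g s).2 I| <= n%:R * B * L.
Proof.
move=> hg gL Ik B0 gB sab tab.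
apply: (@path_increment _ _ _ a b L (n%:R * B) 1 g (fun q => q.2 I)) => //.
- by rewrite mulr_ge0.
- by move=> x y; rewrite mul1r jet_dist_fiber.
move=> u /andP[au ub] [_ du] hv; split; first exact: du.
have := velocity_low hv Ik; rewrite ffunE => ->.
apply: le_trans (ler_norm_sum _ _ _) _.
rewrite -mulrA; apply: sum_ord_le => j.
rewrite normrM mulrC; apply: ler_pM => //; first by apply: gB; rewrite !ltW.
exact: velocity_base_le.
Qed.

(* Bounds a coordinate [i] orders below the top one along a path of length [L] on which
   some point has its fiber coordinates bounded by [r]. *)
Fixpoint jet_bound (R : realType) (n : nat) (r L : R) (i : nat) : R :=
  if i is i'.+1 then r + n%:R * jet_bound n r L i' * L else r + L.

Lemma jet_bound_ge0 (R : realType) (n : nat) (r L : R) (i : nat) :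
  0 <= r -> 0 <= L -> 0 <= jet_bound n r L i.
Proof. by move=> r0 L0; elim: i => [|i IH] /=; rewrite addr_ge0// !mulr_ge0. Qed.

(** From a zero jet the bound is homogeneous in the length: a coordinate [i] orders below the top
    has weight [i + 1]. *)
Lemma jet_bound0 (R : realType) (n : nat) (L : R) (i : nat) :
  jet_bound n 0 L i = n%:R ^+ i * L ^+ i.+1.
Proof.
elim: i => [|i IH] /=; first by rewrite add0r mul1r.
by rewrite add0r IH mulrA -exprS -mulrA -exprSr.
Qed.

Lemma path_length_gt0 (R : realType) (n k : nat) (a b L : R) (g : R -> jet R n k) :
  (path_length a b g < L%:E)%E -> 0 < L.
Proof.
rewrite -lte_fin; apply: le_lt_trans.
by apply: integral_ge0 => t _; rewrite lee_fin hnorm_ge0.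
Qed.

(** Descending induction on the order: top coordinates move no faster than the path, and each
    contact equation integrates once more. The reference time [s] is arbitrary, so the bound serves
    paths leaving the reference jet as well as paths arriving at it. *)
Lemma path_fiber_bound (R : realType) (n k : nat) (a b L r s : R) (g : R -> jet R n k)
    (t : R) (I : midx n k) :
  horizontal_path a b g -> (path_length a b g < L%:E)%E ->
  a <= s <= b -> (forall J, `|(g s).2 J| <= r) -> a <= t <= b ->
  `|(g t).2 I| <= jet_bound n r L (k - mdeg (bmnm I)).
Proof.
move=> hg gL sab gr.
have L0 := path_length_gt0 gL.
have r0 : 0 <= r by apply: le_trans (gr I).
have Ik (J : midx n k) : (mdeg (bmnm J) <= k)%N by rewrite -ltnS; exact: bmdeg.
have tri (u : R) (J : midx n k) : `|(g u).2 J| <= r + `|(g u).2 J - (g s).2 J|.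
  rewrite -[X in `|X| <= _](subrK ((g s).2 J)) addrC; apply: le_trans (ler_normD _ _) _.
  by rewrite lerD2r.
move iE : (k - mdeg (bmnm I))%N => i; elim: i I iE t => [|i IH] I iE t tab.
  apply: le_trans (tri t I) _; rewrite lerD2l; apply: (path_top_increment hg gL) => //.
  by apply/eqP; rewrite eqn_leq Ik /= -subn_eq0 iE.
have Ilt : (mdeg (bmnm I) < k)%N by rewrite -subn_gt0 iE.
apply: le_trans (tri t I) _; rewrite lerD2l; apply: (path_low_increment hg gL) => //.
  by apply: jet_bound_ge0 => //; exact: ltW.
move=> u j uab; apply: IH => //.
by rewrite midx_succE// mdegD mdeg1 addn1 subnS iE.
Qed.

Lemma path_fiber_increment (R : realType) (n k : nat) (a b L B : R) (g : R -> jet R n k)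
    (s t : R) (I : midx n k) :
  horizontal_path a b g -> (path_length a b g < L%:E)%E ->
  (forall u J, a <= u <= b -> `|(g u).2 J| <= B) ->
  a <= s <= b -> a <= t <= b -> `|(g t).2 I - (g s).2 I| <= (1 + n%:R * B) * L.
Proof.
move=> hg gL gB sab tab.
have L0 := path_length_gt0 gL.
have B0 : 0 <= B by apply: le_trans (gB s I sab).
rewrite mulrDl mul1r.
have : (mdeg (bmnm I) <= k)%N by rewrite -ltnS; exact: bmdeg.
rewrite leq_eqVlt => /orP[/eqP Ik|Ik].
  apply: (le_trans (path_top_increment hg gL Ik sab tab)).
  by rewrite lerDl !mulr_ge0// ltW.
apply: (@le_trans _ _ (n%:R * B * L)); last by rewrite lerDr ltW.
by apply: (path_low_increment hg gL Ik B0 _ sab tab) => u j uab; exact: gB.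
Qed.

(** Freeze the coefficients [P] at time [a]. The derivative of [u_I - \sum_j P_j x_j] along the path
    is [\sum_j x_j' (u_(I + e_j) - P_j)], and the bracket is itself O(L) by [path_fiber_increment];
    integration gives the second factor [L]. *)
Lemma path_contact (R : realType) (n k : nat) (a b L B : R) (g : R -> jet R n k)
    (I : midx n k) :
  horizontal_path a b g -> (path_length a b g < L%:E)%E -> (mdeg (bmnm I) < k)%N ->
  (forall u J, a <= u <= b -> `|(g u).2 J| <= B) ->
  `|(g b).2 I - (g a).2 I
    - \sum_(j < n) (g a).2 (midx_succ I j) * ((g b).1 0 j - (g a).1 0 j)|
   <= n%:R * (1 + n%:R * B) * L ^+ 2.
Proof.
move=> hg gL Ik gB; have [ab _ _] := hg.
have L0 := path_length_gt0 gL.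
have aab : a <= a <= b by rewrite lexx.
have B0 : 0 <= B by apply: le_trans (gB a I aab).
pose P j := (g a).2 (midx_succ I j).
have PB (x y : jet R n k) : \sum_(j < n) P j * (x.1 0 j - y.1 0 j) =
    \sum_(j < n) P j * x.1 0 j - \sum_(j < n) P j * y.1 0 j.
  by rewrite -sumrB; apply: eq_bigr => j _; rewrite mulrBr.
pose p (q : jet R n k) := q.2 I - \sum_(j < n) P j * q.1 0 j.
have -> : (g b).2 I - (g a).2 I - \sum_(j < n) P j * ((g b).1 0 j - (g a).1 0 j)
          = p (g b) - p (g a).
  by rewrite /p PB; ring.
rewrite expr2 mulrA.
apply: (@path_increment _ _ _ a b L _ (1 + \sum_(j < n) `|P j|) g p) => //.
- by rewrite !mulr_ge0 ?addr_ge0 ?mulr_ge0// ltW.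
- by rewrite ltr_wpDr// sumr_ge0.
- move=> x y; rewrite (_ : p x - p y = (x.2 I - y.2 I) - \sum_(j < n) P j * (x.1 0 j - y.1 0 j)).
    rewrite mulrDl mul1r mulr_suml; apply: le_trans (ler_normB _ _) _; apply: lerD.
      exact: jet_dist_fiber.
    apply: le_trans (ler_norm_sum _ _ _) _; apply: ler_sum => j _.
    by rewrite normrM ler_wpM2l// jet_dist_base.
  by rewrite /p PB; ring.
- move=> u /andP[au ub] [dx du] hv.
  have dS : is_derive u 1 (fun t => \sum_(j < n) P j * (g t).1 0 j)
      (\sum_(j < n) P j * derive1 (fun t => (g t).1 0 j) u).
    rewrite (_ : (fun t => _) = \sum_(j < n) (fun t => P j * (g t).1 0 j)); last first.
      by apply/funext => t; rewrite fct_sumE.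
    apply: is_derive_sum => j.
    have dxj : is_derive u 1 (fun t => (g t).1 0 j) (derive1 (fun t => (g t).1 0 j) u).
      by rewrite derive1E; exact: derivableP.
    by apply: is_deriveZ.
  have dI : is_derive u 1 (fun t => (g t).2 I) (derive1 (fun t => (g t).2 I) u).
    by rewrite derive1E; exact: derivableP.
  have dp : is_derive u 1 (p \o g) (derive1 (fun t => (g t).2 I) u
      - \sum_(j < n) P j * derive1 (fun t => (g t).1 0 j) u) by apply: is_deriveB.
  have DE : derive1 (p \o g) u = \sum_(j < n) (velocity g u).1 0 j * ((g u).2 (midx_succ I j) - P j).
    rewrite derive1E derive_val; have := velocity_low hv Ik; rewrite ffunE => ->.
    by rewrite -sumrB; apply: eq_bigr => j _; rewrite mxE; ring.
  split; first exact: (@ex_derive _ _ _ _ _ _ _ dp).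
  rewrite DE; apply: le_trans (ler_norm_sum _ _ _) _.
  rewrite -!mulrA; apply: sum_ord_le => j.
  rewrite normrM mulrC mulrA; apply: ler_pM => //; last exact: velocity_base_le.
  by rewrite /P; apply: (@path_fiber_increment _ _ _ a b L B g a u) => //; rewrite !ltW.
by rewrite ab lexx.
Qed.

(** * Jets of polynomials *)

Lemma mpoly_ring_ind (R : comNzRingType) (n : nat) (P : mpoly n R -> Prop) :
  (forall c, P (mpolyC n c)) -> (forall i, P (mpolyX R (mnm1 i))) ->
  (forall p q, P p -> P q -> P (p + q)) -> (forall p q, P p -> P q -> P (p * q)) ->
  forall p, P p.
Proof.
move=> PC PX PD PM; elim/mpolyind => [|c m p _ _ Pp]; first by rewrite -mpolyC0.
apply: (PD) => //; rewrite -mul_mpolyC; apply: (PM) => //.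
rewrite mpolyXE_id; apply: (big_ind P) => [||i _]; [exact: PC|exact: PM|].
elim: (m i) => [|e IH]; first by rewrite expr0; exact: PC.
by rewrite exprS; apply: PM.
Qed.

Lemma multinom_ind (n : nat) (P : multinom n -> Prop) :
  P (@mnm0 n) -> (forall m i, P m -> P (mnm_add m (mnm1 i))) -> forall m, P m.
Proof.
move=> P0 PS m; move de : (mdeg m) => d; elim: d m de => [|d IH] m md.
  by move/eqP: md; rewrite mdeg_eq0 => /eqP ->.
have /existsP[i mi] : [exists i, m i != 0%N].
  apply: contraT => /existsPn m0; move: md; rewrite mdegE big1// => i _.
  by have := m0 i; rewrite negbK => /eqP.
rewrite -lep1mP in mi; rewrite -(submK mi); apply: PS; apply: IH.
by apply/eqP; rewrite -eqSS -md -{2}(submK mi) mdegD mdeg1 addn1.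
Qed.

(** Bound and Lipschitz estimate are proved together, since the product case of the second needs the
    first. *)
Lemma mpoly_lipschitz (R : realType) (n : nat) (f : mpoly n R) :
  exists2 K : R, 0 <= K & forall v w : 'I_n -> R,
    (forall i, `|v i| <= 1) -> (forall i, `|w i| <= 1) ->
    `|meval v f| <= K /\ `|meval v f - meval w f| <= K * \sum_(i < n) `|v i - w i|.
Proof.
have S0 (v w : 'I_n -> R) : 0 <= \sum_(i < n) `|v i - w i| by apply: sumr_ge0.
elim/mpoly_ring_ind : f => [c|i|f g [K K0 fK] [L L0 gL]|f g [K K0 fK] [L L0 gL]].
- exists `|c| => // v w _ _; rewrite !mevalC subrr normr0; split => //.
  by rewrite mulr_ge0.
- exists 1 => // v w v1 w1; rewrite !mevalXU mul1r; split => //.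
  by rewrite (bigD1 i)//= lerDl sumr_ge0.
- exists (K + L); first by rewrite addr_ge0.
  move=> v w v1 w1; have [f1 f2] := fK v w v1 w1; have [g1 g2] := gL v w v1 w1.
  rewrite !mevalD; split; first by apply: le_trans (ler_normD _ _) _; apply: lerD.
  rewrite opprD addrACA mulrDl; apply: le_trans (ler_normD _ _) _.
  exact: lerD.
- exists (K * L + K * L); first by rewrite addr_ge0 ?mulr_ge0.
  move=> v w v1 w1; have [f1 f2] := fK v w v1 w1; have [g1 g2] := gL v w v1 w1.
  have [g3 _] := gL w v w1 v1.
  rewrite !mevalM; split.
    rewrite normrM; apply: (@le_trans _ _ (K * L)); first exact: ler_pM.
    by rewrite lerDl mulr_ge0.
  set S := \sum_(i < n) _ in f2 g2 *.
  rewrite (_ : _ - _ = meval v f * (meval v g - meval w g)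
    + (meval v f - meval w f) * meval w g); last by ring.
  apply: le_trans (ler_normD _ _) _; rewrite [leRHS]mulrDl !normrM; apply: lerD.
    by rewrite -mulrA; apply: ler_pM.
  by rewrite mulrAC; apply: ler_pM.
Qed.

Lemma is_derive_meval_line (R : realType) (n : nat) (f : mpoly n R) (z a : 'I_n -> R) (t : R) :
  is_derive t 1 (fun s : R => meval (fun i => z i + s * a i) f)
    (\sum_(j < n) a j * meval (fun i => z i + t * a i) (mderiv j f)).
Proof.
elim/mpoly_ring_ind : f => [c|i|f g df dg|f g df dg].
- rewrite (_ : (fun s => _) = cst c); last by apply/funext => s; rewrite mevalC.
  rewrite big1; first exact: is_derive_cst.
  by move=> j _; rewrite mderivC meval0 mulr0.
- rewrite (_ : (fun s => _) = (fun s : R => z i + s * a i)); last first.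
    by apply/funext => s; rewrite mevalXU.
  have -> : \sum_(j < n) a j * meval (fun i => z i + t * a i) (mderiv j (mpolyX R (mnm1 i))) = a i.
    rewrite (bigD1 i)//= mderivX mnm1E eqxx scale1r.
    rewrite (_ : mnm_sub _ _ = @mnm0 n); last first.
      by apply/mnmP => l; rewrite mnmBE subnn mnm0E.
    rewrite mpolyX0 meval1 mulr1 big1 ?addr0// => j ji.
    by rewrite mderivX mnm1E eq_sym (negPf ji) scale0r meval0 mulr0.
  rewrite (_ : (fun s => _) = cst (z i) + a i *: (@id R)); last first.
    by apply/funext => s; rewrite /= mulrC.
  apply: is_derive_eq (is_deriveD (is_derive_cst _ _ _) (is_deriveZ _ (is_derive_id _ _))) _.
  by rewrite add0r /GRing.scale /= mulr1.
- rewrite (_ : (fun s => _) = (fun s : R => meval (fun i => z i + s * a i) f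
      + meval (fun i => z i + s * a i) g)); last by apply/funext => s; rewrite mevalD.
  rewrite (eq_bigr (fun j => a j * meval (fun i => z i + t * a i) (mderiv j f)
     + a j * meval (fun i => z i + t * a i) (mderiv j g))); last first.
    by move=> j _; rewrite mderivD mevalD mulrDr.
  by rewrite big_split; apply: is_deriveD.
- rewrite (_ : (fun s => _) = (fun s : R => meval (fun i => z i + s * a i) f
      * meval (fun i => z i + s * a i) g)); last by apply/funext => s; rewrite mevalM.
  apply: is_derive_eq (is_deriveM df dg) _.
  rewrite /GRing.scale /= !mulr_sumr -big_split; apply: eq_bigr => j _ /=.
  by rewrite mderivM mevalD !mevalM; ring.
Qed.

Definition poly_jet (R : realType) (n k : nat) (f : mpoly n R) (x : 'rV[R]_n) : jet R n k :=
  (x, [ffun I : midx n k => meval (fun i => x 0 i) (mderivm (bmnm I) f)]).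

(** Dominates [jet_dist] and splits coordinate by coordinate, which suits the Lipschitz
    estimates. *)
Definition l1_dist (R : realType) (n k : nat) (p q : jet R n k) : R :=
  \sum_(j < n) `|p.1 0 j - q.1 0 j| + \sum_(I : midx n k) `|p.2 I - q.2 I|.

Lemma sqrt_sumsq_le (R : realType) (J : finType) (F : J -> R) :
  Num.sqrt (\sum_(j : J) F j ^+ 2) <= \sum_(j : J) `|F j|.
Proof.
have S0 : 0 <= \sum_(j : J) `|F j| by apply: sumr_ge0.
rewrite -(ger0_norm S0) -sqrtr_sqr ler_sqrt ?sqr_ge0// expr2 mulr_suml.
apply: ler_sum => j _; rewrite -real_normK ?num_real// expr2 ler_wpM2l//.
by rewrite (bigD1 j)//= lerDl sumr_ge0.
Qed.

Lemma sqrt_add_le (R : realType) (x y : R) : 0 <= x -> 0 <= y ->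
  Num.sqrt (x + y) <= Num.sqrt x + Num.sqrt y.
Proof.
move=> x0 y0; have S0 : 0 <= Num.sqrt x + Num.sqrt y by rewrite addr_ge0 ?sqrtr_ge0.
rewrite -(ger0_norm S0) -sqrtr_sqr ler_sqrt ?sqr_ge0// sqrrD !sqr_sqrtr//.
by rewrite addrAC lerDl mulrn_wge0// mulr_ge0 ?sqrtr_ge0.
Qed.

Lemma jet_dist_l1 (R : realType) (n k : nat) (p q : jet R n k) : jet_dist p q <= l1_dist p q.
Proof.
apply: le_trans (sqrt_add_le _ _) _; try by apply: sumr_ge0 => ? _; exact: sqr_ge0.
by apply: lerD; [apply: sqrt_sumsq_le (fun j => _)|apply: sqrt_sumsq_le (fun I => _)].
Qed.

Lemma l1_dist_triangle (R : realType) (n k : nat) (p q r : jet R n k) :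
  l1_dist p r <= l1_dist p q + l1_dist q r.
Proof.
rewrite /l1_dist addrACA; apply: lerD; rewrite -big_split /=; apply: ler_sum => i _; exact: ler_distD.
Qed.

Lemma poly_jet_lipschitz (R : realType) (n k : nat) (f : mpoly n R) :
  exists2 K : R, 0 <= K & forall x y : 'rV[R]_n,
    (forall i, `|x 0 i| <= 1) -> (forall i, `|y 0 i| <= 1) ->
    l1_dist (poly_jet k f x) (poly_jet k f y) <= K * \sum_(i < n) `|x 0 i - y 0 i|.
Proof.
have /choice[K HK] : forall I : midx n k, exists K : R, 0 <= K /\ forall v w : 'I_n -> R,
    (forall i, `|v i| <= 1) -> (forall i, `|w i| <= 1) ->
    `|meval v (mderivm (bmnm I) f) - meval w (mderivm (bmnm I) f)| <= K * \sum_(i < n) `|v i - w i|.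
  move=> I; have [K K0 H] := mpoly_lipschitz (mderivm (bmnm I) f).
  by exists K; split => // v w v1 w1; have [] := H v w v1 w1.
exists (1 + \sum_(I : midx n k) K I).
  by rewrite addr_ge0// sumr_ge0// => I _; have [] := HK I.
move=> x y x1 y1; rewrite mulrDl mul1r lerD2l mulr_suml; apply: ler_sum => I _.
by rewrite !ffunE; have [_] := HK I; apply.
Qed.

(** * Distance bounds from explicit paths of jets *)

Lemma dcc_ltP (R : realType) (n k : nat) (p q : jet R n k) (L : R) :
  (dcc p q < L%:E)%E -> exists a b g,
    [/\ horizontal_path a b g, g a = p, g b = q & (path_length a b g < L%:E)%E].
Proof.
move=> /ereal_inf_lt[_ [a [b [g [hg ga gb ->]]]] gL].
by exists a, b, g.
Qed.

Lemma dcc_le_path (R : realType) (n k : nat) (a b c M : R) (g : R -> jet R n k) :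
  0 <= M -> horizontal_path a b g ->
  (forall t, a <= t <= b -> t != c -> hnorm (g t) (velocity g t) <= M) ->
  (dcc (g a) (g b) <= (M * (b - a))%:E)%E.
Proof.
move=> M0 hg gM; have [ab _ _] := hg.
apply: (@le_trans _ _ (path_length a b g)).
  by apply: ereal_inf_lbound; exists a, b, g.
(* The value [+oo] at the excluded time [c] makes the comparison hold at every point, while [f] is
   constant almost everywhere. *)
pose f (t : R) : \bar R := if t == c then +oo%E else M%:E.
apply: (@le_trans _ _ (\int[@lebesgue_measure R]_(t in `[a, b]) f t)%E).
  apply: le_ge0_integral => t /=; first by rewrite lee_fin hnorm_ge0.
  rewrite in_itv /= => tab; rewrite /f; case: eqP => [_|/eqP tc]; first exact: leey.
  by rewrite lee_fin gM.
have mf : measurable_fun setT f.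
  apply: measurable_fun_ifT; [|exact: measurable_cst|exact: measurable_cst].
  by apply: measurable_fun_eqr; [exact: measurable_id|exact: measurable_cst].
have -> : (\int[@lebesgue_measure R]_(t in `[a, b]) f t
    = \int[@lebesgue_measure R]_(t in `[a, b]) cst M%:E t)%E.
  apply: ae_eq_integral => //; first exact: measurable_funTS.
  exists [set c]; split; [exact: measurable_set1|exact: lebesgue_measure_set1|].
  by move=> t /= h; apply: contrapT => tc; apply: h => _; rewrite /f; case: eqP.
rewrite integral_cst// [X in (_ * X)%E]lebesgue_measure_itv /= lte_fin.
by case: ltP => // ba; rewrite ?mule0 lee_fin mulr_ge0// subr_ge0.
Qed.

Lemma mderiv_mderivm_midx (R : realType) (n k : nat) (f : mpoly n R) (I : midx n k) (j : 'I_n) :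
  (mdeg (bmnm I) < k)%N ->
  mderivm (bmnm (midx_succ I j)) f = mderiv j (mderivm (bmnm I) f).
Proof. by move=> Ik; rewrite midx_succE// mderivmDm mderivmU1m. Qed.

Lemma lipschitz_abs_continuous (R : realType) (T : Type) (d : T -> T -> R) (K a b : R) (g : R -> T) :
  0 <= K -> (forall s t, a <= s -> s <= t -> t <= b -> d (g s) (g t) <= K * (t - s)) ->
  abs_continuous d a b g.
Proof.
move=> K0 gK e e0; exists (e / (K + 1)); first by rewrite divr_gt0// ltr_wpDl.
move=> m s t st _ sr; apply: (@le_lt_trans _ _ (\sum_(i < m) K * (t i - s i))).
  by apply: ler_sum => i _; have [? ? ?] := st i; exact: gK.
rewrite -mulr_sumr; have S0 : 0 <= \sum_(i < m) (t i - s i).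
  by apply: sumr_ge0 => i _; have [_ ? _] := st i; rewrite subr_ge0.
move: sr; rewrite ltr_pdivlMr ?ltr_wpDl// => /(le_lt_trans _); apply.
by rewrite mulrC ler_wpM2l// lerDl.
Qed.

(** For the jet of a polynomial the contact equations are the chain rule. Agreement near [t] is
    enough, so the lemma applies on each half of a path glued from two segments. *)
Lemma near_poly_jet_line (R : realType) (n k : nat) (f : mpoly n R) (z a : 'rV[R]_n)
    (g : R -> jet R n k) (t : R) :
  (\near t, poly_jet k f (z + t *: a) = g t) ->
  [/\ jet_derivable g t, horizontal (g t) (velocity g t) &
    hnorm (g t) (velocity g t) <= \sum_(j < n) `|a 0 j|
      + \sum_(I : midx n k) \sum_(j < n) `|a 0 j| *
         `|meval (fun i => (z + t *: a) 0 i) (mderiv j (mderivm (bmnm I) f))|].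
Proof.
move=> gE.
pose D (I : midx n k) := \sum_(j < n) a 0 j *
  meval (fun i => (z + t *: a) 0 i) (mderiv j (mderivm (bmnm I) f)).
have dx (j : 'I_n) : is_derive t 1 (fun s => (g s).1 0 j) (a 0 j).
  apply: (@near_eq_is_derive _ _ _ (cst (z 0 j) + a 0 j *: (@id R))).
    by near=> s; rewrite -(near gE s)//= !mxE mulrC.
  apply: is_derive_eq (is_deriveD (is_derive_cst _ _ _) (is_deriveZ _ (is_derive_id _ _))) _.
  by rewrite add0r /GRing.scale /= mulr1.
have du (I : midx n k) : is_derive t 1 (fun s => (g s).2 I) (D I).
  apply: (@near_eq_is_derive _ _ _ (fun s : R => meval (fun i => z 0 i + s * a 0 i) (mderivm (bmnm I) f))).
    near=> s; rewrite -(near gE s)//= ffunE; apply: meval_eq => i; by rewrite !mxE.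
  apply: is_derive_eq (is_derive_meval_line _ _ _ _) _.
  apply: eq_bigr => j _; congr (_ * _); apply: meval_eq => i; by rewrite !mxE.
have jd : jet_derivable g t.
  by split => [j|I]; [exact: (@ex_derive _ _ _ _ _ _ _ (dx j))|exact: (@ex_derive _ _ _ _ _ _ _ (du I))].
have vx j : (velocity g t).1 0 j = a 0 j by rewrite mxE derive1E derive_val.
have vu I : (velocity g t).2 I = D I by rewrite ffunE derive1E derive_val.
have hv : horizontal (g t) (velocity g t).
  exists [ffun i : frame_idx n k => match i with inl j => a 0 j | inr J => D (val J) end].
  set c := [ffun i => _].
  rewrite [LHS]surjective_pairing [RHS]surjective_pairing; congr (_, _).
    by apply/rowP => j; rewrite frame_comb_fst vx ffunE.
  apply/ffunP => I; rewrite vu.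
  have : (mdeg (bmnm I) <= k)%N by rewrite -ltnS; exact: bmdeg.
  rewrite leq_eqVlt => /orP[Ik|Ik].
    by have := @frame_comb_snd R n k (g t) c (exist _ I Ik); rewrite /= => ->; rewrite ffunE.
  rewrite frame_comb_low//; apply: eq_bigr => j _; rewrite ffunE; congr (_ * _).
  by rewrite -(nbhs_singleton gE) ffunE mderiv_mderivm_midx.
split => //; rewrite hnormE//; apply: le_trans (sqrt_add_le _ _) _;
  try by apply: sumr_ge0 => ? _; exact: sqr_ge0.
apply: lerD.
  by under eq_bigr do rewrite vx; apply: sqrt_sumsq_le (fun j => _).
apply: le_trans (@sqrt_sumsq_le _ _ (fun J : {I : midx n k | mdeg (bmnm I) == k} => _)) _.
apply: (@le_trans _ _ (\sum_(I : midx n k) `|(velocity g t).2 I|)).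
  rewrite [leRHS](bigID (fun I : midx n k => mdeg (bmnm I) == k)) /=.
  rewrite (reindex_omap (val : {I : midx n k | mdeg (bmnm I) == k} -> _) insub) /=; last first.
    by move=> I Ik; rewrite insubT.
  rewrite [X in _ <= X + _](eq_bigl predT) => [|[I Ik]]; last by rewrite /= insubT /= eqxx andbT Ik.
  by rewrite lerDl sumr_ge0.
apply: ler_sum => I _; rewrite vu; apply: le_trans (ler_norm_sum _ _ _) _.
by apply: ler_sum => j _; rewrite normrM.
Unshelve. all: by end_near. Qed.

Lemma poly_jet_derivative_bound (R : realType) (n k : nat) (f : mpoly n R) :
  exists2 C : R, 0 <= C & forall (x a : 'rV[R]_n) (A : R), (forall i, `|x 0 i| <= 1) ->
    (forall i, `|a 0 i| <= A) ->
    \sum_(I : midx n k) \sum_(j < n) `|a 0 j| *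
         `|meval (fun i => x 0 i) (mderiv j (mderivm (bmnm I) f))| <= C * A.
Proof.
have /choice[K HK] : forall Ij : midx n k * 'I_n, exists K : R, 0 <= K /\ forall v : 'I_n -> R,
    (forall i, `|v i| <= 1) -> `|meval v (mderiv Ij.2 (mderivm (bmnm Ij.1) f))| <= K.
  move=> Ij; have [K K0 H] := mpoly_lipschitz (mderiv Ij.2 (mderivm (bmnm Ij.1) f)).
  by exists K; split => // v v1; have [] := H v v v1 v1.
exists (\sum_(I : midx n k) \sum_(j < n) K (I, j)).
  by apply: sumr_ge0 => I _; apply: sumr_ge0 => j _; have [] := HK (I, j).
move=> x a A x1 aA; rewrite mulr_suml; apply: ler_sum => I _.
rewrite mulr_suml; apply: ler_sum => j _; rewrite mulrC; apply: ler_pM => //.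
exact: (HK (I, j)).2 (fun i => x 0 i) x1.
Qed.

Lemma segment_cube (R : realType) (x y s : R) : `|x| <= 1 -> `|y| <= 1 -> 0 <= s <= 1 ->
  `|x + s * (y - x)| <= 1.
Proof.
move=> x1 y1 /andP[s0 s1].
rewrite (_ : x + s * (y - x) = (1 - s) * x + s * y); last by ring.
apply: le_trans (ler_normD _ _) _; rewrite !normrM (ger0_norm s0) ger0_norm ?subr_ge0//.
have := ler_wpM2l s0 y1; have : (1 - s) * `|x| <= (1 - s) * 1 by rewrite ler_wpM2l// subr_ge0.
lra.
Qed.

(* The path runs along the jet of [f1] towards the common value at [z], then along the
   jet of [f2]. *)
Lemma dcc_poly_jet_le (R : realType) (n k : nat) (f1 f2 : mpoly n R) :
  exists2 C : R, 0 <= C & forall (x z y : 'rV[R]_n) (A : R), 0 <= A ->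
    (forall i, `|x 0 i| <= 1) -> (forall i, `|z 0 i| <= 1) -> (forall i, `|y 0 i| <= 1) ->
    (forall i, `|z 0 i - x 0 i| <= A) -> (forall i, `|y 0 i - z 0 i| <= A) ->
    poly_jet k f1 z = poly_jet k f2 z ->
    (dcc (poly_jet k f1 x) (poly_jet k f2 y) <= (C * A)%:E)%E.
Proof.
have [C1 C10 HC1] := poly_jet_derivative_bound k f1.
have [C2 C20 HC2] := poly_jet_derivative_bound k f2.
(* The speed is at most [(n + C1 + C2) A]; the factor 2 is the length of the parameter interval
   [[-1, 1]], with [z] at time 0. *)
exists ((n%:R + (C1 + C2)) * 2); first by rewrite mulr_ge0// !addr_ge0.
move=> x z y A A0 x1 z1 y1 xA yA fz.
pose a := z - x; pose b := y - z.
pose g (s : R) := if s <= 0 then poly_jet k f1 (z + s *: a) else poly_jet k f2 (z + s *: b).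
have gm s : s <= 0 -> g s = poly_jet k f1 (z + s *: a) by rewrite /g => ->.
have gp s : 0 <= s -> g s = poly_jet k f2 (z + s *: b).
  rewrite le_eqVlt => /orP[/eqP <-|s0]; first by rewrite /g lexx !scale0r !addr0.
  by rewrite /g leNgt s0.
have am i : `|a 0 i| <= A by rewrite !mxE.
have bm i : `|b 0 i| <= A by rewrite !mxE.
have cm s i : -1 <= s <= 0 -> `|(z + s *: a) 0 i| <= 1.
  move=> /andP[s1 s0]; rewrite !mxE.
  rewrite (_ : _ + _ = z 0 i + (- s) * (x 0 i - z 0 i)); last by ring.
  by apply: segment_cube => //; apply/andP; split; lra.
have cp s i : 0 <= s <= 1 -> `|(z + s *: b) 0 i| <= 1.
  by move=> s01; rewrite !mxE; apply: segment_cube.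
have suma (c : 'rV[R]_n) : (forall i, `|c 0 i| <= A) -> \sum_(i < n) `|c 0 i| <= n%:R * A.
  by move=> cA; apply: sum_ord_le.
have [K1 K10 HK1] := poly_jet_lipschitz k f1.
have [K2 K20 HK2] := poly_jet_lipschitz k f2.
have lipm s t : -1 <= s -> s <= t -> t <= 0 -> l1_dist (g s) (g t) <= K1 * (n%:R * A) * (t - s).
  move=> s1 st t0; rewrite !gm//; last exact: le_trans t0.
  apply: le_trans (HK1 _ _ _ _) _; try by move=> i; apply: cm; apply/andP; split; lra.
  rewrite -!mulrA ler_wpM2l// mulrA; apply: (@le_trans _ _ ((\sum_(i < n) `|a 0 i|) * (t - s))).
    rewrite mulr_suml; apply: ler_sum => i _; rewrite !mxE.
    rewrite (_ : _ - _ = - ((z 0 i - x 0 i) * (t - s))); last by ring.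
    by rewrite normrN normrM (ger0_norm (_ : 0 <= t - s))// subr_ge0.
  by rewrite ler_wpM2r ?subr_ge0// suma.
have lipp s t : 0 <= s -> s <= t -> t <= 1 -> l1_dist (g s) (g t) <= K2 * (n%:R * A) * (t - s).
  move=> s0 st t1; rewrite !gp//; last exact: le_trans st.
  apply: le_trans (HK2 _ _ _ _) _; try by move=> i; apply: cp; apply/andP; split; lra.
  rewrite -!mulrA ler_wpM2l// mulrA; apply: (@le_trans _ _ ((\sum_(i < n) `|b 0 i|) * (t - s))).
    rewrite mulr_suml; apply: ler_sum => i _; rewrite !mxE.
    rewrite (_ : _ - _ = - ((y 0 i - z 0 i) * (t - s))); last by ring.
    by rewrite normrN normrM (ger0_norm (_ : 0 <= t - s))// subr_ge0.
  by rewrite ler_wpM2r ?subr_ge0// suma.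
have near_hor t : -1 <= t <= 1 -> t != 0 -> [/\ jet_derivable g t, horizontal (g t) (velocity g t) &
    hnorm (g t) (velocity g t) <= (n%:R + (C1 + C2)) * A].
  move=> /andP[tm1 t1]; rewrite neq_lt => /orP[t0|t0].
    have [|? ? hb] := @near_poly_jet_line R n k f1 z a g t.
      by near=> s; rewrite gm// ltW//; near: s; exact: lt_nbhsl.
    split => //; apply: le_trans hb _; rewrite mulrDl mulrDl; apply: lerD; first exact: suma.
    apply: (@le_trans _ _ (C1 * A)); last by rewrite lerDl mulr_ge0.
    by apply: HC1 => // i; apply: cm; rewrite tm1 ltW.
  have [|? ? hb] := @near_poly_jet_line R n k f2 z b g t.
    by near=> s; rewrite gp// ltW//; near: s; exact: lt_nbhsr.
  split => //; apply: le_trans hb _; rewrite mulrDl mulrDl; apply: lerD; first exact: suma.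
  apply: (@le_trans _ _ (C2 * A)); last by rewrite lerDr mulr_ge0.
  by apply: HC2 => // i; apply: cp; rewrite t1 ltW.
have hg : horizontal_path (-1) 1 g.
  split; first by lra.
    apply: (@lipschitz_abs_continuous _ _ _ ((K1 + K2) * (n%:R * A))).
      by rewrite mulr_ge0 ?addr_ge0 ?mulr_ge0.
    have nA : 0 <= n%:R * A by rewrite mulr_ge0.
    move=> s t s1 st t1; apply: le_trans (jet_dist_l1 _ _) _; rewrite mulrDl mulrDl.
    have [t0|t0] := leP t 0.
      apply: le_trans (lipm _ _ s1 st t0) _.
      by rewrite lerDl !mulr_ge0 ?subr_ge0.
    have [s0|s0] := leP 0 s.
      apply: le_trans (lipp _ _ s0 st t1) _.
      by rewrite lerDr !mulr_ge0 ?subr_ge0.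
    apply: le_trans (l1_dist_triangle _ (g 0) _) _.
    apply: lerD.
      apply: le_trans (lipm _ _ s1 (ltW s0) (lexx _)) _.
      by apply: ler_wpM2l; [rewrite !mulr_ge0|lra].
    apply: le_trans (lipp _ _ (lexx _) (ltW t0) t1) _.
    by apply: ler_wpM2l; [rewrite !mulr_ge0|lra].
  exists [set 0]; split; [exact: measurable_set1|exact: lebesgue_measure_set1|].
  move=> t /= nt; apply: contrapT => /eqP tn; apply: nt; rewrite in_itv /= => t1.
  by have [] := near_hor t t1 tn.
have -> : poly_jet k f1 x = g (-1).
  rewrite gm; last by lra.
  by rewrite scaleN1r /a opprB addrC subrK.
have -> : poly_jet k f2 y = g 1.
  rewrite gp; last by lra.
  by rewrite scale1r /b addrC subrK.
rewrite mulrAC (_ : 2 = 1 - -1); last by lra.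
apply: (@dcc_le_path _ _ _ _ _ 0) => //.
  by rewrite mulr_ge0// !addr_ge0.
by move=> t t1 /(near_hor t t1)[].
Unshelve. all: by end_near. Qed.

(** * The embedding of the sphere *)

(** Cauchy-Schwarz, from Lagrange's identity. *)
Lemma sum_mul_le_sqrt (R : realType) (m : nat) (a b : 'I_m -> R) :
  \sum_i a i * b i <= Num.sqrt (\sum_i a i ^+ 2) * Num.sqrt (\sum_i b i ^+ 2).
Proof.
have A0 : 0 <= \sum_i a i ^+ 2 by apply: sumr_ge0 => i _; exact: sqr_ge0.
have B0 : 0 <= \sum_i b i ^+ 2 by apply: sumr_ge0 => i _; exact: sqr_ge0.
rewrite -sqrtrM//; apply: le_trans (ler_norm _) _; rewrite -sqrtr_sqr ler_sqrt ?mulr_ge0//.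
rewrite -subr_ge0 -(pmulr_rge0 _ (ltr0n R 2 : 0 < 2)).
suff -> : 2 * ((\sum_i a i ^+ 2) * (\sum_i b i ^+ 2) - (\sum_i a i * b i) ^+ 2)
    = \sum_i \sum_j (a i * b j - a j * b i) ^+ 2.
  by do 2![apply: sumr_ge0 => ? _]; exact: sqr_ge0.
have E (x y : 'I_m -> R) : (\sum_i x i) * (\sum_i y i) = \sum_i \sum_j x i * y j.
  by rewrite mulr_suml; apply: eq_bigr => i _; rewrite mulr_sumr.
have E2 (x y z : R) : 2 * (x * y - z ^+ 2) = x * y + y * x - 2 * (z * z) by ring.
rewrite E2 !E mulr_sumr -big_split -sumrB /=; apply: eq_bigr => i _.
by rewrite mulr_sumr -big_split -sumrB /=; apply: eq_bigr => j _; ring.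
Qed.

(** * Euclidean norm *)

Lemma euclid_norm_ge0 (R : realType) (m : nat) (v : 'rV[R]_m) : 0 <= euclid_norm v.
Proof. exact: sqrtr_ge0. Qed.

Lemma euclid_norm_sqr (R : realType) (m : nat) (v : 'rV[R]_m) :
  euclid_norm v ^+ 2 = \sum_(i < m) v 0 i ^+ 2.
Proof. by rewrite sqr_sqrtr// sumr_ge0// => i _; exact: sqr_ge0. Qed.

Lemma euclid_normD (R : realType) (m : nat) (v w : 'rV[R]_m) :
  euclid_norm (v + w) <= euclid_norm v + euclid_norm w.
Proof.
have S0 : 0 <= euclid_norm v + euclid_norm w by rewrite addr_ge0 ?euclid_norm_ge0.
rewrite -(@ler_pXn2r _ 2)// ?nnegrE ?euclid_norm_ge0// sqrrD !euclid_norm_sqr.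
under eq_bigr do rewrite mxE sqrrD.
rewrite 2!big_split /= lerD2r lerD2l sumrMnl ler_pMn2r//.
exact: sum_mul_le_sqrt.
Qed.

Lemma euclid_normZ (R : realType) (m : nat) (c : R) (v : 'rV[R]_m) :
  euclid_norm (c *: v) = `|c| * euclid_norm v.
Proof.
rewrite /euclid_norm; under eq_bigr do rewrite mxE exprMn.
by rewrite -mulr_sumr sqrtrM ?sqr_ge0// sqrtr_sqr.
Qed.

Lemma euclid_normN (R : realType) (m : nat) (v : 'rV[R]_m) :
  euclid_norm (- v) = euclid_norm v.
Proof. by rewrite -scaleN1r euclid_normZ normrN1 mul1r. Qed.

Lemma euclid_normB_sym (R : realType) (m : nat) (v w : 'rV[R]_m) :
  euclid_norm (v - w) = euclid_norm (w - v).
Proof. by rewrite -euclid_normN opprB. Qed.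

Lemma euclid_norm_dist (R : realType) (m : nat) (v w : 'rV[R]_m) :
  `|euclid_norm v - euclid_norm w| <= euclid_norm (v - w).
Proof.
rewrite ler_norml lerNl opprB !lerBlDr; apply/andP; split.
  by rewrite euclid_normB_sym; apply: le_trans (euclid_normD _ _); rewrite subrK.
by apply: le_trans (euclid_normD _ _); rewrite subrK.
Qed.

Lemma euclid_coord_le (R : realType) (m : nat) (v : 'rV[R]_m) (i : 'I_m) :
  `|v 0 i| <= euclid_norm v.
Proof. by have := @le_sqrt_sum R _ (fun i => v 0 i) 0 i (lexx _); rewrite addr0. Qed.

Lemma euclid_norm_le_sum (R : realType) (m : nat) (v : 'rV[R]_m) :
  euclid_norm v <= \sum_(i < m) `|v 0 i|.
Proof. exact: (sqrt_sumsq_le (fun i => v 0 i)). Qed.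

Lemma euclid_norm_le_max (R : realType) (m : nat) (v : 'rV[R]_m) (e : R) :
  (forall i, `|v 0 i| <= e) -> euclid_norm v <= m%:R * e.
Proof. by move=> ve; apply: le_trans (euclid_norm_le_sum _) _; exact: sum_ord_le. Qed.

Lemma euclid_norm_eq0 (R : realType) (m : nat) (v : 'rV[R]_m) : euclid_norm v = 0 -> v = 0.
Proof.
move=> v0; apply/rowP => i; rewrite mxE; apply/normr0_eq0/eqP.
by rewrite eq_le normr_ge0 andbT -v0 euclid_coord_le.
Qed.

Lemma euclid_norm0 (R : realType) (m : nat) : euclid_norm (0 : 'rV[R]_m) = 0.
Proof. by rewrite -[X in euclid_norm X](scale0r 0) euclid_normZ normr0 mul0r. Qed.

Lemma euclid_norm_split (R : realType) (m : nat) (v : 'rV[R]_m.+1) :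
  euclid_norm v ^+ 2 = euclid_norm (col' ord_max v : 'rV[R]_m) ^+ 2 + v 0 ord_max ^+ 2.
Proof.
rewrite !euclid_norm_sqr (bigD1_ord ord_max)//= addrC; congr (_ + _).
by apply: eq_bigr => i _; rewrite mxE.
Qed.

(** Radial projection; at the origin, which has no direction, a basis vector is taken instead. *)
Lemma unit_vector_near (R : realType) (n : nat) (x : 'rV[R]_n) :
  (0 < n)%N -> euclid_norm x <= 1 ->
  exists2 z : 'rV[R]_n, euclid_norm z = 1 & euclid_norm (z - x) = 1 - euclid_norm x.
Proof.
move=> n0 x1; have [x0|x0] := eqVneq (euclid_norm x) 0.
  exists (delta_mx 0 (Ordinal n0)); last first.
    rewrite (euclid_norm_eq0 x0) subr0 euclid_norm0 subr0.
    rewrite /euclid_norm (bigD1 (Ordinal n0))//= mxE !eqxx expr1n big1 ?addr0 ?sqrtr1// => i i0.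
    by rewrite mxE (negPf i0) expr0n.
  rewrite /euclid_norm (bigD1 (Ordinal n0))//= mxE !eqxx expr1n big1 ?addr0 ?sqrtr1// => i i0.
  by rewrite mxE (negPf i0) expr0n.
have xp : 0 < euclid_norm x by rewrite lt_neqAle eq_sym x0 euclid_norm_ge0.
exists ((euclid_norm x)^-1 *: x).
  by rewrite euclid_normZ ger0_norm ?invr_ge0 ?ltW// mulVf.
rewrite -{3}[x]scale1r -scalerBl euclid_normZ ger0_norm.
  by rewrite mulrBl mulVf// mul1r.
by rewrite subr_ge0 invr_ge1 ?unitfE.
Qed.

(** * The polynomial whose jets form the upper sheet *)

Lemma mderiv_expn_dvd (R : comNzRingType) (n : nat) (i : 'I_n) (f : mpoly n R) (c : nat) :
  exists h, mderiv i (f ^+ c.+1) = f ^+ c * h.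
Proof.
elim: c => [|c [h IH]]; first by exists (mderiv i f); rewrite expr1 expr0 mul1r.
exists (mderiv i f + h); rewrite exprS mderivM IH exprS; ring.
Qed.

(** By the Leibniz rule each derivative costs one factor [f]. *)
Lemma mderivm_expn_dvd (R : comNzRingType) (n : nat) (f : mpoly n R) (e : nat) (m : multinom n) :
  (mdeg m <= e)%N -> exists g, mderivm m (f ^+ e) = f ^+ (e - mdeg m) * g.
Proof.
elim/multinom_ind : m => [|m i IH].
  by exists 1; rewrite mderivm0m mdeg0 subn0 mulr1.
rewrite mdegD mdeg1 addn1 => me; have [g Hg] := IH (ltnW me).
rewrite mderivmDm mderivmU1m Hg.
rewrite -(subnSK me) mderivM; have [h ->] := mderiv_expn_dvd i f (e - (mdeg m).+1).
by exists (h * g + f * mderiv i g); rewrite exprS; ring.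
Qed.

Definition ball_poly (R : realType) (n k : nat) : mpoly n R :=
  (1 - \sum_(i < n) mpolyX R (mnm1 i) ^+ 2) ^+ k.+1.

Lemma meval_ball_poly (R : realType) (n k : nat) (x : 'rV[R]_n) :
  meval (fun i => x 0 i) (ball_poly R n k) = (1 - euclid_norm x ^+ 2) ^+ k.+1.
Proof.
rewrite rmorphXn /= mevalB meval1 euclid_norm_sqr (big_morph _ (mevalD _) (meval0 _)).
by under eq_bigr do rewrite expr2 mevalM !mevalXU -expr2.
Qed.

Lemma poly_jet_boundary (R : realType) (n k : nat) (x : 'rV[R]_n) :
  euclid_norm x = 1 -> poly_jet k (ball_poly R n k) x = poly_jet k 0 x.
Proof.
move=> x1; congr (_, _); apply/ffunP => I; rewrite !ffunE raddf0 meval0.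
have Ik : (mdeg (bmnm I) <= k)%N by rewrite -ltnS; exact: bmdeg.
have [g ->] := @mderivm_expn_dvd _ _ (1 - \sum_(i < n) mpolyX R (mnm1 i) ^+ 2) k.+1 (bmnm I) (leqW Ik).
rewrite mevalM rmorphXn /= mevalB meval1 (big_morph _ (mevalD _) (meval0 _)).
under eq_bigr do rewrite expr2 mevalM !mevalXU -expr2.
by rewrite -euclid_norm_sqr x1 expr1n subrr subSn// exprS !mul0r.
Qed.

(** * Consequences of a small distance *)

Lemma mdeg_mnm0_lt (n k : nat) : (mdeg (@mnm0 n) < k.+1)%N.
Proof. by rewrite mdeg0. Qed.

Definition midx0 (n k : nat) : midx n k := BMultinom (mdeg_mnm0_lt n k).

Lemma dcc_base_le (R : realType) (n k : nat) (p q : jet R n k) (L : R) (j : 'I_n) :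
  (dcc p q < L%:E)%E -> `|q.1 0 j - p.1 0 j| <= L.
Proof.
move=> /dcc_ltP[a [b [g [hg <- <- gL]]]]; have [ab _ _] := hg.
by apply: (path_base_increment j hg gL); rewrite lexx ab.
Qed.

Lemma dcc_gt0 (R : realType) (n k : nat) (p q : jet R n k) (L : R) :
  (dcc p q < L%:E)%E -> 0 < L.
Proof. by move=> /dcc_ltP[a [b [g [_ _ _ /path_length_gt0]]]]. Qed.

(* The homogeneity of the metric at a zero jet: [u_0] has weight [k + 1]. *)
Lemma dcc_zero_jet (R : realType) (n k : nat) (p q : jet R n k) (L : R) :
  (dcc p q < L%:E)%E \/ (dcc q p < L%:E)%E -> p.2 = 0 ->
  `|q.2 (midx0 n k)| <= n%:R ^+ k * L ^+ k.+1.
Proof.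
move=> dL p0.
have [a [b [g [s [t [hg gL sab tab [gs gt]]]]]]] : exists a b g s t,
    [/\ horizontal_path a b g, (path_length a b g < L%:E)%E, a <= s <= b, a <= t <= b &
        g s = p /\ g t = q].
  case: dL => /dcc_ltP[a [b [g [hg ga gb gL]]]]; have [ab _ _] := hg.
    by exists a, b, g, a, b; rewrite !lexx ab.
  by exists a, b, g, b, a; rewrite !lexx ab.
have := @path_fiber_bound _ _ _ a b L 0 s g t (midx0 n k) hg gL sab.
rewrite mdeg0 subn0 jet_bound0 -gt; apply => //.
by move=> J; rewrite gs p0 ffunE normr0.
Qed.

(* Central projection of the sphere to the double cone [|x| + |t| = 1] makes both
   hemispheres graphs over the unit ball in a biLipschitz way, which the orthogonal
   projection does not do at the equator. *)
Definition cone_norm (R : realType) (n : nat) (v : 'rV[R]_n.+1) : R :=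
  euclid_norm (col' ord_max v : 'rV[R]_n) + `|v 0 ord_max|.

Definition cone_base (R : realType) (n : nat) (v : 'rV[R]_n.+1) : 'rV[R]_n :=
  (cone_norm v)^-1 *: (col' ord_max v : 'rV[R]_n).

(** On the equator [cone_base] has norm 1, where both branches give the zero jet. *)
Definition sphere_embedding (R : realType) (n k : nat) (v : 'rV[R]_n.+1) : jet R n k :=
  poly_jet k (if 0 <= v 0 ord_max then ball_poly R n k else 0) (cone_base v).

Lemma col'B (R : realType) (n : nat) (v w : 'rV[R]_n.+1) :
  col' ord_max (v - w) = col' ord_max v - col' ord_max w :> 'rV[R]_n.
Proof. by apply/rowP => i; rewrite !mxE. Qed.

Lemma euclid_norm_col' (R : realType) (n : nat) (v : 'rV[R]_n.+1) :
  euclid_norm (col' ord_max v : 'rV[R]_n) <= euclid_norm v.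
Proof.
rewrite -(@ler_pXn2r _ 2)// ?nnegrE ?euclid_norm_ge0// euclid_norm_split lerDl.
exact: sqr_ge0.
Qed.

Lemma euclid_norm_le_cone (R : realType) (n : nat) (v : 'rV[R]_n.+1) :
  euclid_norm v <= cone_norm v.
Proof.
have N0 : 0 <= cone_norm v by rewrite addr_ge0 ?euclid_norm_ge0.
rewrite -(@ler_pXn2r _ 2)// ?nnegrE ?euclid_norm_ge0// euclid_norm_split sqrrD.
by rewrite real_normK ?num_real// addrAC lerDl mulrn_wge0// mulr_ge0 ?euclid_norm_ge0.
Qed.

Lemma cone_norm_le (R : realType) (n : nat) (v : 'rV[R]_n.+1) :
  cone_norm v <= 2 * euclid_norm v.
Proof.
rewrite mulr_natl mulr2n; apply: lerD; first exact: euclid_norm_col'.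
exact: euclid_coord_le.
Qed.

Lemma cone_norm_dist (R : realType) (n : nat) (v w : 'rV[R]_n.+1) :
  `|cone_norm v - cone_norm w| <= 2 * euclid_norm (v - w).
Proof.
rewrite /cone_norm opprD addrACA; apply: le_trans (ler_normD _ _) _.
rewrite mulr_natl mulr2n; apply: lerD.
  by apply: le_trans (euclid_norm_dist _ _) _; rewrite -col'B; exact: euclid_norm_col'.
apply: le_trans (ler_dist_dist _ _) _.
by have := euclid_coord_le (v - w) ord_max; rewrite !mxE.
Qed.

Lemma cone_norm_sphere (R : realType) (n : nat) (v : 'rV[R]_n.+1) :
  euclid_norm v = 1 -> 1 <= cone_norm v <= 2.
Proof.
by move=> v1; have := cone_norm_le v; have := euclid_norm_le_cone v; rewrite v1 mulr1 => -> ->.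
Qed.

(** The projected point satisfies [|x| + |t| = 1], so its base determines its height up to sign. *)
Lemma cone_height (R : realType) (n : nat) (v : 'rV[R]_n.+1) :
  0 < cone_norm v -> `|v 0 ord_max| / cone_norm v = 1 - euclid_norm (cone_base v).
Proof.
move=> N0; have -> : `|v 0 ord_max| = cone_norm v - euclid_norm (col' ord_max v : 'rV[R]_n).
  by rewrite /cone_norm addrAC subrr add0r.
by rewrite euclid_normZ gtr0_norm ?invr_gt0// mulrBl divff ?lt0r_neq0// mulrC.
Qed.

Lemma cone_base_le1 (R : realType) (n : nat) (v : 'rV[R]_n.+1) :
  0 < cone_norm v -> euclid_norm (cone_base v) <= 1.
Proof.
by move=> N0; rewrite -subr_ge0 -cone_height// divr_ge0// ltW.
Qed.

(** The constant is 1 for the numerator plus 2 for [cone_norm] in the denominator, which is at least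
    1 on the sphere. *)
Lemma cone_base_lipschitz (R : realType) (n : nat) (v w : 'rV[R]_n.+1) :
  euclid_norm v = 1 -> euclid_norm w = 1 ->
  euclid_norm (cone_base v - cone_base w) <= 3 * euclid_norm (v - w).
Proof.
move=> v1 w1; have /andP[Nv _] := cone_norm_sphere v1; have /andP[Nw _] := cone_norm_sphere w1.
set M := cone_norm v in Nv; set N := cone_norm w in Nw.
have M0 : 0 < M by lra. have N0 : 0 < N by lra.
have -> : cone_base v - cone_base w = M^-1 *: (col' ord_max (v - w) : 'rV[R]_n)
    + (M^-1 * N^-1 * (N - M)) *: (col' ord_max w : 'rV[R]_n).
  apply/rowP => i; rewrite !mxE -/M -/N; field; by rewrite !lt0r_neq0.
apply: le_trans (euclid_normD _ _) _; rewrite !euclid_normZ.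
have Mi : `|M^-1| <= 1 by rewrite gtr0_norm ?invr_gt0// invf_le1.
have c1 : `|M^-1| * euclid_norm (col' ord_max (v - w) : 'rV[R]_n) <= euclid_norm (v - w).
  by apply: le_trans (euclid_norm_col' _); rewrite ler_piMl ?euclid_norm_ge0.
have c2 : `|M^-1 * N^-1 * (N - M)| * euclid_norm (col' ord_max w : 'rV[R]_n) <=
    2 * euclid_norm (v - w).
  rewrite !normrM -!mulrA; apply: (@le_trans _ _ (1 * `|N - M|)); last first.
    by rewrite mul1r distrC; exact: cone_norm_dist.
  apply: ler_pM => //; first by rewrite !mulr_ge0 ?euclid_norm_ge0.
  rewrite mulrCA ler_piMr// gtr0_norm ?invr_gt0// mulrC ler_pdivrMr// mul1r.
  by rewrite lerDl.
lra.
Qed.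

(** With [d] the difference of the projected points, [v - w] is [M d] plus a multiple of [w] of
    length [|M - N| / N]. Since [v] and [w] are unit vectors, [1/M] and [1/N] are the norms of the
    projected points, so [|M - N| <= M N |d|]; with [M <= 2] both terms are at most [2 |d|]. *)
Lemma sphere_dist_le_cone (R : realType) (n : nat) (v w : 'rV[R]_n.+1) :
  euclid_norm v = 1 -> euclid_norm w = 1 ->
  euclid_norm (v - w) <= 4 * (euclid_norm (cone_base v - cone_base w)
    + `|v 0 ord_max / cone_norm v - w 0 ord_max / cone_norm w|).
Proof.
move=> v1 w1; have /andP[Nv Mv] := cone_norm_sphere v1; have /andP[Nw _] := cone_norm_sphere w1.
set M := cone_norm v in Nv Mv *; set N := cone_norm w in Nw *.
have M0 : 0 < M by lra. have N0 : 0 < N by lra.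
pose d := M^-1 *: v - N^-1 *: w.
have dE : euclid_norm d <= euclid_norm (cone_base v - cone_base w)
    + `|v 0 ord_max / M - w 0 ord_max / N|.
  apply: le_trans (euclid_norm_le_cone _) _; rewrite /cone_norm; apply: lerD.
    by rewrite le_eqVlt; apply/orP; left; apply/eqP; congr euclid_norm; apply/rowP => i; rewrite !mxE.
  by rewrite !mxE mulrC [N^-1 * _]mulrC.
have NM : `|M - N| <= M * N * euclid_norm d.
  have := euclid_norm_dist (M^-1 *: v) (N^-1 *: w).
  rewrite !euclid_normZ v1 w1 !mulr1 (gtr0_norm (_ : 0 < M^-1)) ?invr_gt0//.
  rewrite (gtr0_norm (_ : 0 < N^-1)) ?invr_gt0// -/d => h.
  have -> : M - N = - (M * N * (M^-1 - N^-1)) by field; rewrite !lt0r_neq0.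
  by rewrite normrN normrM (gtr0_norm (mulr_gt0 M0 N0)) ler_pM2l ?mulr_gt0.
have -> : v - w = M *: d + ((M - N) / N) *: w.
  by apply/rowP => i; rewrite !mxE; field; rewrite !lt0r_neq0.
apply: le_trans (euclid_normD _ _) _; rewrite !euclid_normZ w1 mulr1 normrM (gtr0_norm M0).
rewrite (gtr0_norm (_ : 0 < N^-1)) ?invr_gt0//.
have c : `|M - N| / N <= M * euclid_norm d by rewrite ler_pdivrMr// mulrAC.
have : M * euclid_norm d <= 2 * euclid_norm d by rewrite ler_wpM2r ?euclid_norm_ge0.
lra.
Qed.

(** On a common hemisphere the path follows a single sheet. Otherwise the last coordinates have
    opposite signs, so the height of [v] is at most [|v - w|], and the path changes sheets over the
    boundary point [z] nearest to the base of [v]. From [z] to the base of [w] the distance is at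
    most [d + 3 d], whence [4 d]. *)
Lemma sphere_embedding_upper (R : realType) (n k : nat) : (0 < n)%N ->
  exists2 C : R, 0 <= C & forall v w : 'rV[R]_n.+1, euclid_norm v = 1 -> euclid_norm w = 1 ->
    (dcc (sphere_embedding k v) (sphere_embedding k w) <= (C * euclid_norm (v - w))%:E)%E.
Proof.
move=> n0.
pose F (s : bool) : mpoly n R := if s then ball_poly R n k else 0.
have /choice[C HC] : forall st : bool * bool, exists C : R, 0 <= C /\ forall (x z y : 'rV[R]_n) (A : R),
    0 <= A ->
    (forall i, `|x 0 i| <= 1) -> (forall i, `|z 0 i| <= 1) -> (forall i, `|y 0 i| <= 1) ->
    (forall i, `|z 0 i - x 0 i| <= A) -> (forall i, `|y 0 i - z 0 i| <= A) ->
    poly_jet k (F st.1) z = poly_jet k (F st.2) z ->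
    (dcc (poly_jet k (F st.1) x) (poly_jet k (F st.2) y) <= (C * A)%:E)%E.
  by move=> [s t]; have [C C0 H] := dcc_poly_jet_le k (F s) (F t); exists C.
have C0 st : 0 <= C st by have [] := HC st.
exists (\sum_(st : bool * bool) C st * 4).
  by apply: sumr_ge0 => st _; rewrite mulr_ge0.
move=> v w v1 w1.
have /andP[Nv _] := cone_norm_sphere v1; have /andP[Nw _] := cone_norm_sphere w1.
have x1 := @cone_base_le1 _ _ v (lt_le_trans ltr01 Nv).
have y1 := @cone_base_le1 _ _ w (lt_le_trans ltr01 Nw).
set d := euclid_norm (v - w); have d0 : 0 <= d by exact: euclid_norm_ge0.
have xy : euclid_norm (cone_base v - cone_base w) <= 3 * d by exact: cone_base_lipschitz.
pose st := (0 <= v 0 ord_max, 0 <= w 0 ord_max).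
have coord (x : 'rV[R]_n) : euclid_norm x <= 1 -> forall i, `|x 0 i| <= 1.
  by move=> xn i; apply: le_trans (euclid_coord_le _ _) xn.
have coordB (x y : 'rV[R]_n) e : euclid_norm (x - y) <= e -> forall i, `|x 0 i - y 0 i| <= e.
  by move=> xn i; have := le_trans (euclid_coord_le (x - y) i) xn; rewrite !mxE.
suff [z [z1 zx zy fz]] : exists z : 'rV[R]_n, [/\ euclid_norm z <= 1,
    euclid_norm (z - cone_base v) <= 4 * d, euclid_norm (cone_base w - z) <= 4 * d &
    poly_jet k (F st.1) z = poly_jet k (F st.2) z].
  apply: (@le_trans _ _ (C st * (4 * d))%:E).
    apply: ((HC st).2 _ z) => //; try exact: coord; try exact: coordB.
    by rewrite mulr_ge0.
  rewrite lee_fin mulrA ler_wpM2r// (bigD1 st)//= lerDl.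
  by apply: sumr_ge0 => ? _; rewrite mulr_ge0.
have [stE|stN] := eqVneq st.1 st.2.
  exists (cone_base v); split => //; last by rewrite stE.
    by rewrite subrr euclid_norm0 mulr_ge0.
  by rewrite euclid_normB_sym; lra.
have height (u : 'rV[R]_n.+1) : 1 <= cone_norm u ->
    1 - euclid_norm (cone_base u) <= `|u 0 ord_max|.
  move=> Nu; rewrite -cone_height; last exact: lt_le_trans Nu.
  by rewrite ler_pdivrMr ?ler_peMr//; exact: lt_le_trans Nu.
have dt : `|v 0 ord_max| <= d.
  apply: (@le_trans _ _ `|v 0 ord_max - w 0 ord_max|); last first.
    by have := euclid_coord_le (v - w) ord_max; rewrite !mxE.
  move: stN; rewrite /st /=; case: (leP 0 (v 0 ord_max)) => hv; case: (leP 0 (w 0 ord_max)) => hw // _.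
    by rewrite !ger0_norm; lra.
  by rewrite !ler0_norm; lra.
have [z z1 zx] := unit_vector_near n0 x1.
exists z; have zxd : euclid_norm (z - cone_base v) <= d.
  by rewrite zx; apply: le_trans dt; exact: height.
split; first by rewrite z1.
- lra.
- rewrite (_ : cone_base w - z = (cone_base w - cone_base v) + (cone_base v - z)); last first.
    by rewrite addrA subrK.
  apply: le_trans (euclid_normD _ _) _; rewrite euclid_normB_sym (euclid_normB_sym _ z); lra.
- by rewrite /F /st /=; do 2!case: ifP => _ //; rewrite poly_jet_boundary.
Qed.

Lemma poly_jet0 (R : realType) (n k : nat) (x : 'rV[R]_n) : (poly_jet k 0 x).2 = 0.
Proof. by apply/ffunP => I; rewrite !ffunE raddf0 meval0. Qed.

Lemma ball_poly_jet_value (R : realType) (n k : nat) (x : 'rV[R]_n) :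
  (poly_jet k (ball_poly R n k) x).2 (midx0 n k) = (1 - euclid_norm x ^+ 2) ^+ k.+1.
Proof. by rewrite ffunE mderivm0m meval_ball_poly. Qed.

(** A root of order [k + 1] is extracted from [(1 - |x|^2)^(k+1) <= n^k L^(k+1) <= (n L)^(k+1)], and
    [1 - |x| <= 1 - |x|^2] on the unit ball. *)
Lemma ball_poly_jet_depth (R : realType) (n k : nat) (p : jet R n k) (x : 'rV[R]_n) (L : R) :
  (0 < n)%N -> euclid_norm x <= 1 -> p.2 = 0 ->
  (dcc p (poly_jet k (ball_poly R n k) x) < L%:E)%E \/
  (dcc (poly_jet k (ball_poly R n k) x) p < L%:E)%E ->
  1 - euclid_norm x <= n%:R * L.
Proof.
move=> n0 x1 p0 dL; have L0 : 0 < L by case: dL => /dcc_gt0.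
have r0 := euclid_norm_ge0 x; set r := euclid_norm x in r0 x1 *.
apply: (@le_trans _ _ (1 - r ^+ 2)).
  by rewrite lerD2l lerN2 expr2 ler_piMl.
have r2 : 0 <= 1 - r ^+ 2 by rewrite subr_ge0 expr_le1.
have n1 : 1 <= n%:R :> R by rewrite ler1n.
rewrite -(@ler_pXn2r _ k.+1)// ?nnegrE//; last by rewrite mulr_ge0// ltW.
have := dcc_zero_jet dL p0; rewrite ball_poly_jet_value => h.
apply: le_trans (ler_norm _) _; apply: le_trans h _; rewrite exprMn.
apply: ler_wpM2r; first by rewrite exprn_ge0// ltW.
by rewrite [leRHS]exprS ler_peMl// exprn_ge0.
Qed.

(** The bases differ by at most [n L]. On a common sheet the heights differ by the difference of the
    base norms. On opposite sheets the height over the first sheet is at most [n L] by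
    [ball_poly_jet_depth], the other one at most [2 n L], so the signed heights differ by at most
    [3 n L]. In total [4 (1 + 3) n L]. *)
Lemma sphere_embedding_lower (R : realType) (n k : nat) (v w : 'rV[R]_n.+1) (L : R) :
  (0 < n)%N -> euclid_norm v = 1 -> euclid_norm w = 1 ->
  (dcc (sphere_embedding k v) (sphere_embedding k w) < L%:E)%E ->
  euclid_norm (v - w) <= 16 * n%:R * L.
Proof.
move=> n0 v1 w1 dL.
have /andP[Nv _] := cone_norm_sphere v1; have /andP[Nw _] := cone_norm_sphere w1.
have Nv0 := lt_le_trans ltr01 Nv; have Nw0 := lt_le_trans ltr01 Nw.
have x1 := cone_base_le1 Nv0; have y1 := cone_base_le1 Nw0.
have L0 := dcc_gt0 dL.
have n1 : 1 <= n%:R :> R by rewrite ler1n.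
have nL : 0 <= n%:R * L by rewrite mulr_ge0// ltW.
have xy : euclid_norm (cone_base v - cone_base w) <= n%:R * L.
  apply: euclid_norm_le_max => i; rewrite !mxE distrC.
  by have := dcc_base_le i dL; rewrite !mxE.
apply: le_trans (sphere_dist_le_cone v1 w1) _.
have hv := cone_height Nv0; have hw := cone_height Nw0.
have rd := euclid_norm_dist (cone_base v) (cone_base w).
move: dL hv hw; rewrite /sphere_embedding.
set x := cone_base v in x1 xy rd *; set y := cone_base w in y1 xy rd *.
case: (leP 0 (v 0 ord_max)) => sv; case: (leP 0 (w 0 ord_max)) => sw dL hv hw.
- rewrite (ger0_norm sv) in hv; rewrite (ger0_norm sw) in hw.
  rewrite hv hw distrC.
  rewrite (_ : 1 - euclid_norm y - (1 - euclid_norm x) = euclid_norm x - euclid_norm y); last by ring.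
  lra.
- have := ball_poly_jet_depth n0 x1 (poly_jet0 k y) (or_intror dL).
  rewrite (ger0_norm sv) in hv; rewrite (ltr0_norm sw) mulNr in hw.
  rewrite hv -[w 0 ord_max / _]opprK hw => hx.
  rewrite ger0_norm; last by rewrite opprK; lra.
  move: rd; rewrite ler_norml => /andP[rd1 rd2]; lra.
- have := ball_poly_jet_depth n0 y1 (poly_jet0 k x) (or_introl dL).
  rewrite (ltr0_norm sv) mulNr in hv; rewrite (ger0_norm sw) in hw.
  rewrite hw -[v 0 ord_max / _]opprK hv => hx.
  rewrite ler0_norm; last lra.
  move: rd; rewrite ler_norml => /andP[rd1 rd2]; lra.
- rewrite (ltr0_norm sv) mulNr in hv; rewrite (ltr0_norm sw) mulNr in hw.
  rewrite -[v 0 ord_max / _]opprK -[w 0 ord_max / _]opprK hv hw.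
  rewrite (_ : - (1 - euclid_norm x) - - (1 - euclid_norm y) = euclid_norm x - euclid_norm y); last by ring.
  lra.
Qed.

Lemma sphere_embedding_biLipschitz (R : realType) (n k : nat) : (0 < n)%N ->
  biLipschitz_embedding (@euclid_dist R n.+1) (@dcc R n k) (@euclid_sphere R n.+1)
    (@sphere_embedding R n k).
Proof.
move=> n0; have [C C0 HC] := @sphere_embedding_upper R n k n0.
(* The summand 1 gives [K >= 1] and makes [K] strictly larger than [16 n], so that a distance below
   [d / K] leads to [d < d]. *)
pose K : R := C + 16 * n%:R + 1.
have K1 : 1 <= K by rewrite lerDr addr_ge0// mulr_ge0.
have K0 : 0 < K by apply: lt_le_trans K1.
exists K => // v w v1 w1; split; last first.
  apply: le_trans (HC v w v1 w1) _; rewrite lee_fin ler_wpM2r ?euclid_norm_ge0//.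
  by rewrite /K -addrA lerDl addr_ge0// mulr_ge0.
rewrite leNgt; apply/negP => dL.
have := sphere_embedding_lower n0 v1 w1 dL.
have := dcc_gt0 dL; rewrite -/(euclid_dist v w); set d := euclid_dist v w => d0 h.
rewrite pmulr_rgt0 ?invr_gt0// in d0.
have : d < d; last by rewrite ltxx.
apply: le_lt_trans h _; rewrite mulrA -[ltRHS]mul1r ltr_pM2r//.
rewrite ltr_pdivrMr// mul1r /K; lra.
Qed.

(** * Absence of Lipschitz extensions *)

Definition jet_sup_bound (R : realType) (n k : nat) (r L : R) : R :=
  \sum_(i < k.+1) jet_bound n r L i.

Lemma jet_sup_bound_ge0 (R : realType) (n k : nat) (r L : R) :
  0 <= r -> 0 <= L -> 0 <= jet_sup_bound n k r L.
Proof. by move=> r0 L0; apply: sumr_ge0 => i _; exact: jet_bound_ge0. Qed.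

Lemma path_sup_bound (R : realType) (n k : nat) (a b r L : R) (g : R -> jet R n k) (t : R)
    (I : midx n k) :
  horizontal_path a b g -> (path_length a b g < L%:E)%E ->
  (forall J, `|(g a).2 J| <= r) -> a <= t <= b -> `|(g t).2 I| <= jet_sup_bound n k r L.
Proof.
move=> hg gL ga tab; have [ab _ _] := hg.
have aab : a <= a <= b by rewrite lexx.
apply: le_trans (path_fiber_bound I hg gL aab ga tab) _.
have r0 : 0 <= r by apply: le_trans (ga I).
have L0 := path_length_gt0 gL.
have kI : (k - mdeg (bmnm I) < k.+1)%N by rewrite ltnS leq_subr.
rewrite /jet_sup_bound (bigD1 (Ordinal kI))//= lerDl sumr_ge0// => i _.
by apply: jet_bound_ge0 => //; exact: ltW.
Qed.

Lemma dcc_sup_bound (R : realType) (n k : nat) (p q : jet R n k) (r L : R) (I : midx n k) :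
  (dcc p q < L%:E)%E -> (forall J, `|p.2 J| <= r) -> `|q.2 I| <= jet_sup_bound n k r L.
Proof.
move=> /dcc_ltP[a [b [g [hg ga gb gL]]]] pr; have [ab _ _] := hg.
rewrite -gb; apply: (path_sup_bound I hg gL); last by rewrite lexx ab.
by move=> J; rewrite ga.
Qed.

(** The a priori bound [M] on the length fixes [B], so that the constants do not depend on [L]. *)
Lemma dcc_contact (R : realType) (n k : nat) (p q : jet R n k) (r L M : R) :
  (dcc p q < L%:E)%E -> L <= M -> (forall J, `|p.2 J| <= r) ->
  let B := jet_sup_bound n k r M in
  [/\ forall j, `|q.1 0 j - p.1 0 j| <= L,
      forall I, `|q.2 I - p.2 I| <= (1 + n%:R * B) * L &
      forall I : midx n k, (mdeg (bmnm I) < k)%N ->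
        `|q.2 I - p.2 I - \sum_(j < n) p.2 (midx_succ I j) * (q.1 0 j - p.1 0 j)|
        <= n%:R * (1 + n%:R * B) * L ^+ 2].
Proof.
move=> dL LM pr B; split; first by move=> j; exact: dcc_base_le dL.
all: have [a [b [g [hg ga gb gL]]]] := dcc_ltP dL; have [ab _ _] := hg.
all: have gB : forall u J, a <= u <= b -> `|(g u).2 J| <= B.
- move=> u J; apply: path_sup_bound hg _ _; last by rewrite ga.
  by apply: lt_le_trans gL _; rewrite lee_fin.
- move=> I; rewrite -gb -ga; apply: path_fiber_increment hg gL gB _ _; rewrite lexx ab//.
- move=> u J; apply: path_sup_bound hg _ _; last by rewrite ga.
  by apply: lt_le_trans gL _; rewrite lee_fin.
- by move=> I Ik; rewrite -gb -ga; apply: path_contact hg gL Ik gB.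
Qed.

(* A Lipschitz map to the unit ball that is the radial projection to the sphere outside
   the ball of radius 1/2. *)
Definition to_ball (R : realType) (n : nat) (w : 'rV[R]_n.+1)  : 'rV[R]_n.+1 :=
  (Num.max (euclid_norm w) 2^-1)^-1 *: w.

(* Sends a vertical segment over [y] in the prism [|y| <= 1, |s| <= 1] to the vertical
   chord over [y] of the double cone [|y| + |t| <= 1]. *)
Definition prism_to_cone (R : realType) (n : nat) (w : 'rV[R]_n.+1) : 'rV[R]_n.+1 :=
  \row_d (if unlift ord_max d is Some j then w 0 d
          else w 0 ord_max * (1 - euclid_norm (col' ord_max w : 'rV[R]_n))).

Lemma to_ball_le1 (R : realType) (n : nat) (w : 'rV[R]_n.+1) : euclid_norm (to_ball w) <= 1.
Proof.
rewrite euclid_normZ gtr0_norm ?invr_gt0 ?lt_max ?invr_gt0 ?ltr0n ?orbT//.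
rewrite mulrC ler_pdivrMr ?lt_max ?invr_gt0 ?ltr0n ?orbT// mul1r le_max lexx//.
Qed.

Lemma to_ball_lipschitz (R : realType) (n : nat) (u w : 'rV[R]_n.+1) :
  euclid_norm (to_ball u - to_ball w) <= 4 * euclid_norm (u - w).
Proof.
rewrite /to_ball; set a := Num.max (euclid_norm u) _; set b := Num.max (euclid_norm w) _.
have a2 : 2^-1 <= a by rewrite le_max lexx orbT.
have b2 : 2^-1 <= b by rewrite le_max lexx orbT.
have h2 : 0 < 2^-1 :> R by rewrite invr_gt0.
have a0 : 0 < a by lra. have b0 : 0 < b by lra.
have ab : `|b - a| <= euclid_norm (u - w).
  rewrite distrC; apply: le_trans (euclid_norm_dist u w); rewrite /a /b !maxEle.
  case: (leP (euclid_norm u) 2^-1) => h1; case: (leP (euclid_norm w) 2^-1) => h3 //.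
  - by rewrite subrr normr0.
  - by rewrite !ler0_norm; lra.
  - by rewrite !ger0_norm; lra.
have bw : euclid_norm w / b <= 1 by rewrite ler_pdivrMr// mul1r le_max lexx.
have ai : a^-1 <= 2 by rewrite -[leRHS]invrK lef_pV2 ?posrE.
have -> : a^-1 *: u - b^-1 *: w = a^-1 *: (u - w) + (a^-1 * ((b - a) / b)) *: w.
  by apply/rowP => i; rewrite !mxE; field; rewrite !lt0r_neq0.
apply: le_trans (euclid_normD _ _) _; rewrite !euclid_normZ !normrM.
rewrite (gtr0_norm (_ : 0 < a^-1)) ?invr_gt0// (gtr0_norm (_ : 0 < b^-1)) ?invr_gt0//.
have d0 := euclid_norm_ge0 (u - w).
have c1 : a^-1 * euclid_norm (u - w) <= 2 * euclid_norm (u - w) by rewrite ler_wpM2r.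
have c2 : a^-1 * (`|b - a| / b) * euclid_norm w <= 2 * euclid_norm (u - w).
  rewrite (_ : _ * euclid_norm w = a^-1 * (`|b - a| * (euclid_norm w / b))); last by ring.
  apply: ler_pM => //; first by rewrite invr_ge0 ltW.
    by rewrite mulr_ge0// divr_ge0 ?euclid_norm_ge0// ltW.
  by apply: le_trans ab; rewrite ler_piMr.
lra.
Qed.

Lemma prism_to_cone_col' (R : realType) (n : nat) (w : 'rV[R]_n.+1) :
  col' ord_max (prism_to_cone w) = col' ord_max w :> 'rV[R]_n.
Proof. by apply/rowP => i; rewrite !mxE liftK. Qed.

Lemma prism_to_cone_max (R : realType) (n : nat) (w : 'rV[R]_n.+1) :
  prism_to_cone w 0 ord_max =
  w 0 ord_max * (1 - euclid_norm (col' ord_max w : 'rV[R]_n)).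
Proof. by rewrite mxE unlift_none. Qed.

(** Of the constant [2 n + 1], one [n] comes from the base, 1 from the height and the other [n] from
    the norm of the base, which scales the height. *)
Lemma prism_to_cone_lipschitz (R : realType) (n : nat) (u w : 'rV[R]_n.+1) (e : R) :
  (forall d, `|w 0 d - u 0 d| <= e) ->
  euclid_norm (col' ord_max u : 'rV[R]_n) <= 1 -> `|w 0 ord_max| <= 1 ->
  euclid_norm (prism_to_cone w - prism_to_cone u) <= (2 * n%:R + 1) * e.
Proof.
move=> we u1 w1.
have cw : euclid_norm (col' ord_max w - col' ord_max u : 'rV[R]_n) <= n%:R * e.
  by apply: euclid_norm_le_max => i; have := we (lift ord_max i); rewrite !mxE.
apply: le_trans (euclid_norm_le_cone _) _; rewrite /cone_norm col'B !prism_to_cone_col'.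
rewrite mxE [(- prism_to_cone u) _ _]mxE !prism_to_cone_max.
set r := euclid_norm (col' ord_max u : 'rV[R]_n) in u1 *; set s := euclid_norm (col' ord_max w : 'rV[R]_n).
have sr : `|s - r| <= n%:R * e by apply: le_trans cw; exact: euclid_norm_dist.
have r0 : 0 <= r by exact: euclid_norm_ge0.
have -> : w 0 ord_max * (1 - s) - u 0 ord_max * (1 - r) =
   (w 0 ord_max - u 0 ord_max) * (1 - r) - w 0 ord_max * (s - r) by ring.
have c1 : `|(w 0 ord_max - u 0 ord_max) * (1 - r)| <= e.
  by rewrite normrM; apply: le_trans (we ord_max); rewrite ler_piMr// ger0_norm; lra.
have c2 : `|w 0 ord_max * (s - r)| <= n%:R * e.
  by rewrite normrM; apply: le_trans sr; rewrite ler_piMl.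
have := ler_normB ((w 0 ord_max - u 0 ord_max) * (1 - r)) (w 0 ord_max * (s - r)).
lra.
Qed.

Lemma col'Z (R : realType) (n : nat) (c : R) (v : 'rV[R]_n.+1) :
  col' ord_max (c *: v) = c *: col' ord_max v :> 'rV[R]_n.
Proof. by apply/rowP => i; rewrite !mxE. Qed.

(** Since [cone_norm v <= 2 |v|], a point of the double cone has norm at least 1/2. There [to_ball]
    is the radial projection to the sphere, inverse to the central projection behind [cone_base]. *)
Lemma sphere_embedding_to_ball (R : realType) (n k : nat) (v : 'rV[R]_n.+1) :
  cone_norm v = 1 ->
  euclid_norm (to_ball v) = 1 /\
  sphere_embedding k (to_ball v) =
    poly_jet k (if 0 <= v 0 ord_max then ball_poly R n k else 0) (col' ord_max v).
Proof.
move=> v1.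
have v2 : 2^-1 <= euclid_norm v.
  have := cone_norm_le v; rewrite v1; lra.
have v0 : 0 < euclid_norm v by apply: lt_le_trans v2; rewrite invr_gt0.
have tE : to_ball v = (euclid_norm v)^-1 *: v by rewrite /to_ball (max_idPl v2).
have c0 : 0 < (euclid_norm v)^-1 by rewrite invr_gt0.
split; first by rewrite tE euclid_normZ gtr0_norm// mulVf// lt0r_neq0.
rewrite tE; set c := (euclid_norm v)^-1 in c0 *.
have Nc : cone_norm (c *: v) = c.
  rewrite /cone_norm col'Z euclid_normZ mxE normrM (gtr0_norm c0) -mulrDr.
  by rewrite -[X in _ * X]/(cone_norm v) v1 mulr1.
rewrite /sphere_embedding mxE pmulr_rge0// /cone_base Nc col'Z scalerA mulVf ?scale1r//.
exact: lt0r_neq0.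
Qed.

Lemma cone_norm_prism_to_cone (R : realType) (n : nat) (w : 'rV[R]_n.+1) :
  euclid_norm (col' ord_max w : 'rV[R]_n) <= 1 ->
  `|w 0 ord_max| = 1 \/ euclid_norm (col' ord_max w : 'rV[R]_n) = 1 ->
  cone_norm (prism_to_cone w) = 1.
Proof.
move=> y1 [s1|s1]; rewrite /cone_norm prism_to_cone_col' prism_to_cone_max normrM.
  by rewrite s1 mul1r ger0_norm ?subr_ge0// addrC subrK.
by rewrite s1 subrr normr0 mulr0 addr0.
Qed.

(** Comparison with [psi 0] bounds the fiber coordinates of [psi] on the whole ball; [dcc_contact]
    then applies with uniform constants. The range of [e] up to [n + 1] leaves room for points
    pushed to the lateral boundary of the prism, which may move [n + 1] times as far as the given
    pair. *)
Lemma jet_contact_inside (R : realType) (n k : nat) (psi : 'rV[R]_n.+1 -> jet R n k) :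
  (0 < k)%N ->
  Lipschitz_map (@euclid_dist R n.+1) (@dcc R n k) (@euclid_ball R n.+1) psi ->
  let Psi w := psi (to_ball (prism_to_cone w)) in
  exists2 D : R, 0 <= D & forall (u w : 'rV[R]_n.+1) (e : R), 0 < e <= n%:R + 1 ->
    euclid_norm (col' ord_max u : 'rV[R]_n) <= 1 -> `|w 0 ord_max| <= 1 ->
    (forall d, `|w 0 d - u 0 d| <= e) ->
    [/\ forall j, `|(Psi w).1 0 j - (Psi u).1 0 j| <= D * e,
        forall I, `|(Psi w).2 I - (Psi u).2 I| <= D * e &
        `|(Psi w).2 (midx0 n k) - (Psi u).2 (midx0 n k) - \sum_(j < n)
            (Psi u).2 (midx_succ (midx0 n k) j) * ((Psi w).1 0 j - (Psi u).1 0 j)|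
        <= D * e ^+ 2].
Proof.
move=> k0 [C0 C00 lip] Psi.
pose r := \sum_(I : midx n k) `|(psi 0).2 I|.
have r0 : 0 <= r by apply: sumr_ge0.
pose r1 := jet_sup_bound n k r (C0 + 1).
have r10 : 0 <= r1 by apply: jet_sup_bound_ge0 => //; rewrite addr_ge0.
have psi_bound v I : euclid_norm v <= 1 -> `|(psi v).2 I| <= r1.
  move=> v1; apply: (@dcc_sup_bound _ _ _ (psi 0)) => [|J].
    apply: le_lt_trans (lip _ _ _ _) _ => //.
      by rewrite /euclid_ball /= euclid_norm0.
    rewrite lte_fin /euclid_dist sub0r euclid_normN.
    by apply: (@le_lt_trans _ _ C0); [rewrite ler_piMr|rewrite ltrDl].
  by rewrite /r (bigD1 J)//= lerDl sumr_ge0.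
(* The Lipschitz constants of [psi], [to_ball] and [prism_to_cone] multiply; the summand 1 makes the
   bound on the distance strict. *)
pose C1 := C0 * (4 * (2 * n%:R + 1)) + 1.
have C10 : 0 < C1 by rewrite ltr_wpDl// !mulr_ge0// addr_ge0.
pose M := C1 * (n%:R + 1).
pose B := jet_sup_bound n k r1 M.
have M0 : 0 <= M by apply: mulr_ge0; [exact: ltW|exact: addr_ge0].
have B0 : 0 <= B by exact: jet_sup_bound_ge0.
have nB : 0 <= 1 + n%:R * B by rewrite addr_ge0// mulr_ge0.
pose D := C1 + (1 + n%:R * B) * C1 + n%:R * (1 + n%:R * B) * C1 ^+ 2.
have D1 : 0 <= C1 by exact: ltW.
have D2 : 0 <= (1 + n%:R * B) * C1 by rewrite mulr_ge0.
have D3 : 0 <= n%:R * (1 + n%:R * B) * C1 ^+ 2 by rewrite !mulr_ge0.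
exists D; first by rewrite /D addr_ge0// addr_ge0.
move=> u w e /andP[e0 en] u1 w1 uw.
have dL : (dcc (Psi u) (Psi w) < (C1 * e)%:E)%E.
  apply: le_lt_trans (lip _ _ _ _) _; [exact: to_ball_le1|exact: to_ball_le1|].
  rewrite lte_fin; apply: (@le_lt_trans _ _ (C0 * (4 * ((2 * n%:R + 1) * e)))).
    rewrite ler_wpM2l// /euclid_dist; apply: le_trans (to_ball_lipschitz _ _) _.
    by rewrite ler_wpM2l// euclid_normB_sym; exact: prism_to_cone_lipschitz.
  by rewrite /C1 [ltRHS]mulrDl mul1r -!mulrA ltrDl.
have LM : C1 * e <= M by rewrite /M ler_wpM2l// ltW.
have pr J : `|(Psi u).2 J| <= r1 by apply: psi_bound; exact: to_ball_le1.
have [H1 H2 H3] := dcc_contact dL LM pr; rewrite -/B in H2 H3.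
have e2 : 0 <= e ^+ 2 by exact: sqr_ge0.
split.
- move=> j; apply: le_trans (H1 j) _; apply: ler_wpM2r; first exact: ltW.
  by rewrite /D -addrA lerDl addr_ge0.
- move=> I; apply: le_trans (H2 I) _; rewrite mulrA; apply: ler_wpM2r; first exact: ltW.
  by rewrite /D addrAC lerDr addr_ge0.
- apply: le_trans (H3 (midx0 n k) _) _; first by rewrite /= mdeg0.
  by rewrite exprMn mulrA; apply: ler_wpM2r => //; rewrite /D lerDr addr_ge0.
Qed.

(** [contact_obstruction] is applied to the extension transported to the cube. On the top and bottom
    faces of the prism the transported map is the jet of [ball_poly] and the zero jet; on its
    lateral boundary both coincide with the zero jet, so the continuation by zero jets fits. *)
Lemma sphere_embedding_no_extension (R : realType) (n k : nat) (psi : 'rV[R]_n.+1 -> jet R n k) :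
  (0 < k)%N -> (0 < n)%N ->
  Lipschitz_map (@euclid_dist R n.+1) (@dcc R n k) (@euclid_ball R n.+1) psi ->
  (forall x, euclid_sphere x -> psi x = sphere_embedding k x) -> False.
Proof.
move=> k0 n0 lip ext.
have [D D0 inside] := jet_contact_inside k0 lip.
pose col (w : 'rV[R]_n.+1) : 'rV[R]_n := col' ord_max w.
(* Zero jets extend the map from the prism over the unit ball to the whole cube. *)
pose Psi w := if euclid_norm (col w) <= 1 then psi (to_ball (prism_to_cone w)) else poly_jet k 0 (col w).
have PsiI w : euclid_norm (col w) <= 1 -> Psi w = psi (to_ball (prism_to_cone w)) by rewrite /Psi => ->.
have PsiO w : 1 < euclid_norm (col w) -> Psi w = poly_jet k 0 (col w).
  by rewrite /Psi ltNge => /negbTE ->.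
have PsiB w : euclid_norm (col w) <= 1 -> `|w 0 ord_max| = 1 \/ euclid_norm (col w) = 1 ->
    Psi w = poly_jet k (if 0 <= w 0 ord_max * (1 - euclid_norm (col w)) then ball_poly R n k else 0)
      (col w).
  move=> w1 wb; rewrite PsiI//.
  have [t1 tE] := sphere_embedding_to_ball k (cone_norm_prism_to_cone w1 wb).
  by rewrite ext// tE prism_to_cone_max prism_to_cone_col'.
have PsiE w : euclid_norm (col w) = 1 -> Psi w = poly_jet k 0 (col w).
  move=> w1; rewrite PsiB; [|by rewrite w1|by right].
  by case: ifP => // _; exact: poly_jet_boundary.
pose f (y : 'rV[R]_n) : R := if euclid_norm y <= 1 then (1 - euclid_norm y ^+ 2) ^+ k.+1 else 0.
pose I0 := midx0 n k.
pose P (w : 'rV[R]_n.+1) : 'rV[R]_n := \row_j (Psi w).2 (midx_succ I0 j).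
have n1 : 0 <= n%:R :> R by [].
pose E := n%:R + 1 : R.
have E1 : 1 <= E by rewrite /E lerDr.
pose C := D * E + n%:R + (D * E ^+ 2 + n%:R * (D * E * n%:R)) + 1.
have DE : 0 <= D * E by rewrite mulr_ge0// (le_trans _ E1).
have DE2 : 0 <= D * E ^+ 2 by rewrite mulr_ge0// sqr_ge0.
have DE3 : 0 <= n%:R * (D * E * n%:R) by rewrite !mulr_ge0// (le_trans _ E1).
(* For a pair on the two sides of the lateral boundary, [v] is the point of that boundary over the
   radial projection of the base of [w], at the height of [w]. As [Psi v] and [Psi w] are both zero
   jets, only the base changes between them. *)
have proj (u w : 'rV[R]_n.+1) e : 0 < e -> euclid_norm (col u) <= 1 -> 1 < euclid_norm (col w) ->
    (forall d, `|w 0 d - u 0 d| <= e) ->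
    exists v : 'rV[R]_n.+1, [/\ euclid_norm (col v) = 1, v 0 ord_max = w 0 ord_max,
      forall d, `|v 0 d - u 0 d| <= E * e & forall j, `|col w 0 j - col v 0 j| <= n%:R * e].
  move=> e0 u1 w1 uw.
  have w0 : 0 < euclid_norm (col w) by apply: lt_trans w1.
  pose y := (euclid_norm (col w))^-1 *: col w.
  pose v : 'rV[R]_n.+1 := \row_d (if unlift ord_max d is Some j then y 0 j else w 0 ord_max).
  have vy : col v = y by apply/rowP => j; rewrite mxE mxE liftK.
  have wy : euclid_norm (col w - y) <= n%:R * e.
    have -> : col w - y = (1 - (euclid_norm (col w))^-1) *: col w by rewrite scalerBl scale1r.
    rewrite euclid_normZ ger0_norm ?subr_ge0 ?invf_le1 ?(ltW w1)// mulrBl mulVf ?lt0r_neq0// mul1r.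
    apply: (@le_trans _ _ (euclid_norm (col w) - euclid_norm (col u))); first by rewrite lerD2l lerN2.
    apply: le_trans (ler_norm _) _; apply: le_trans (euclid_norm_dist _ _) _.
    by apply: euclid_norm_le_max => j; have := uw (lift ord_max j); rewrite !mxE.
  have wyj j : `|col w 0 j - y 0 j| <= n%:R * e.
    by apply: le_trans wy; have := euclid_coord_le (col w - y) j; rewrite mxE [(- y) _ _]mxE.
  exists v; split.
  - by rewrite vy euclid_normZ gtr0_norm ?invr_gt0// mulVf// lt0r_neq0.
  - by rewrite mxE unlift_none.
  - move=> d; rewrite mxE; case: unliftP => [j ->|->].
      have := wyj j; have := uw (lift ord_max j); rewrite [col w 0 j]mxE.
      have := ler_distD (w 0 (lift ord_max j)) (y 0 j) (u 0 (lift ord_max j)).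
      rewrite (distrC (y 0 j) (w 0 _)) /E; lra.
    apply: le_trans (uw ord_max) _; rewrite ler_peMl// ltW//.
  - by move=> j; rewrite vy.
(* Coordinates at most [1/(2 n)] give Euclidean norm at most 1/2, where [1 - |y|^2 >= 1/2]. *)
apply: (@contact_obstruction R n (fun w => (Psi w).1) (fun w => (Psi w).2 I0) P f
  (C : R) (2 * n%:R)^-1 (2^-1 ^+ k.+1)).
- by rewrite ltr_wpDl// !addr_ge0.
- by rewrite invr_gt0 mulr_gt0// ltr0n.
- by rewrite exprn_gt0// invr_gt0.
- move=> u w e /andP[e0 e1] uc wc uw.
  have CE1 : D * E * e + n%:R * e <= C * e.
    by rewrite -mulrDl ler_wpM2r ?(ltW e0)// /C -!addrA !lerD2l ler_wpDr ?addr_ge0.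
  have e2 : 0 <= e ^+ 2 by exact: sqr_ge0.
  have eE : 0 < E * e <= n%:R + 1.
    rewrite mulr_gt0//=; last exact: lt_le_trans E1.
    by rewrite ler_piMr// addr_ge0.
  have ne : 0 <= n%:R * e by rewrite mulr_ge0// ltW.
  have CE2 : D * (E * e) ^+ 2 + n%:R * (D * (E * e) * (n%:R * e)) <= C * e ^+ 2.
    rewrite (_ : _ + _ = (D * E ^+ 2 + n%:R * (D * E * n%:R)) * e ^+ 2); last by ring.
    by apply: ler_wpM2r => //; rewrite /C -addrA addrCA lerDl !addr_ge0.
  have T0 (F : 'I_n -> R) (J : 'I_n -> midx n k) (y : 'rV[R]_n) :
      \sum_(j < n) (poly_jet k 0 y).2 (J j) * F j = 0.
    by apply: big1 => j _; rewrite poly_jet0 ffunE mul0r.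
  have Z0 (y : 'rV[R]_n) I : (poly_jet k 0 y).2 I = 0 by rewrite poly_jet0 ffunE.
  have -> : \sum_(j < n) P u 0 j * ((Psi w).1 0 j - (Psi u).1 0 j) =
      \sum_(j < n) (Psi u).2 (midx_succ I0 j) * ((Psi w).1 0 j - (Psi u).1 0 j).
    by apply: eq_bigr => j _; rewrite mxE.
  have e1E : 0 < e <= n%:R + 1 by rewrite e0 (le_trans e1).
  have DEe : D * e <= D * E * e by apply: ler_wpM2r; [exact: ltW|rewrite ler_peMr].
  have DEe2 : D * e ^+ 2 <= D * (E * e) ^+ 2.
    by rewrite exprMn [leRHS]mulrA; apply: ler_wpM2r => //; rewrite ler_peMr// exprn_ege1.
  have Q0 : 0 <= n%:R * (D * (E * e) * (n%:R * e)).
    by rewrite !mulr_ge0// ?(ltW e0)// (le_trans _ E1).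
  case: (leP (euclid_norm (col u)) 1) => u1; case: (leP (euclid_norm (col w)) 1) => w1.
  + rewrite !PsiI//; have [H1 _ H3] := inside u w e e1E u1 (wc ord_max) uw.
    split; first by move=> j; apply: le_trans (H1 j) _; lra.
    by apply: le_trans H3 _; lra.
  (* The error exceeds that from [u] to [v] by [\sum_j P_j (w_j - v_j)], again quadratic: [P]
     vanishes at [v], hence is O(e) at [u]. *)
  + have [v [v1 vm vu vw]] := proj u w e e0 u1 w1 uw.
    have vm1 : `|v 0 ord_max| <= 1 by rewrite vm.
    have [H1 H2 H3] := inside u v (E * e) eE u1 vm1 vu.
    rewrite -!PsiI// in H1 H2 H3; try by rewrite v1.
    rewrite (PsiO w w1) (PsiE v v1) in H1 H2 H3 *; rewrite !Z0 in H3 *; split.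
      move=> j; apply: le_trans (ler_distD (col v 0 j) _ _) _.
      by have := vw j; have := H1 j; lra.
    set S1 := \sum_(j < n) _ in H3; set S2 := \sum_(j < n) _.
    have -> : S2 = S1 + \sum_(j < n) (Psi u).2 (midx_succ I0 j) * (col w 0 j - col v 0 j).
      by rewrite -big_split; apply: eq_bigr => j _ /=; ring.
    rewrite opprD addrA; apply: le_trans (ler_normB _ _) _; apply: le_trans CE2.
    apply: lerD => //; apply: le_trans (ler_norm_sum _ _ _) _; apply: sum_ord_le => j.
    rewrite normrM; apply: ler_pM => //.
    by have := H2 (midx_succ I0 j); rewrite Z0 sub0r normrN.
  (* Here [P] vanishes at [u] as well as at [v], so the contact estimate from [v] to [w] is already
     the required one. *)
  + have wu d : `|u 0 d - w 0 d| <= e by rewrite distrC.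
    have [v [v1 vm vw vu]] := proj w u e e0 w1 u1 wu.
    have vw' d : `|w 0 d - v 0 d| <= E * e by rewrite distrC.
    have v1' : euclid_norm (col v) <= 1 by rewrite v1.
    have [H1 _ H3] := inside v w (E * e) eE v1' (wc ord_max) vw'.
    rewrite -!PsiI// in H1 H3; try by rewrite v1.
    rewrite (PsiO u u1) (PsiE v v1) in H1 H3 *; rewrite !Z0 !T0 in H3 *; split.
      move=> j; apply: le_trans (ler_distD (col v 0 j) _ _) _.
      by have := vu j; rewrite (distrC (col u 0 j)); have := H1 j => /=; lra.
    by apply: le_trans H3 _; lra.
  + rewrite (PsiO u u1) (PsiO w w1) !Z0 T0 !subr0 normr0; split; last first.
      by rewrite mulr_ge0// /C !addr_ge0.
    move=> j; rewrite !mxE; apply: le_trans (uw _) _; rewrite ler_peMl ?(ltW e0)//.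
    by rewrite /C lerDr !addr_ge0.
- move=> w wc [d wd] /=; rewrite /f -/(col w).
  have [w1|w1] := leP (euclid_norm (col w)) 1; last first.
    by rewrite PsiO// poly_jet0 ffunE mulr0; split => // j; rewrite /= mxE.
  have wb : `|w 0 ord_max| = 1 \/ euclid_norm (col w) = 1.
    case: (unliftP ord_max d) wd => [j ->|->] wd; [right|by left].
    by apply/eqP; rewrite eq_le w1 -wd; have := euclid_coord_le (col w) j; rewrite mxE.
  have [y1|y1] := eqVneq (euclid_norm (col w)) 1.
    by rewrite PsiE// poly_jet0 ffunE y1 expr1n subrr exprS mul0r mulr0; split => // j; rewrite /= mxE.
  have {wb} wm : `|w 0 ord_max| = 1 by case: wb => // /eqP; rewrite (negPf y1).
  have y2 : euclid_norm (col w) < 1 by rewrite lt_neqAle y1.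
  rewrite PsiB//; last by left.
  split; first by move=> j; rewrite /= mxE.
  rewrite pmulr_lge0 ?subr_gt0//; case: leP => ws.
    rewrite ger0_norm// in wm; rewrite wm ball_poly_jet_value.
    by rewrite (_ : (1 + 1) / 2 = 1) ?mul1r//; field.
  rewrite ltr0_norm// in wm; rewrite -[w 0 ord_max]opprK wm subrr !mul0r poly_jet0 ffunE//.
- move=> y; rewrite /f; case: ifP => // y1; rewrite exprn_ge0// subr_ge0 expr_le1//.
  exact: euclid_norm_ge0.
- move=> y yr; have y2 : euclid_norm y <= 2^-1.
    apply: le_trans (euclid_norm_le_max yr) _.
    by rewrite invfM mulrCA divff ?mulr1// pnatr_eq0 -lt0n.
  have := euclid_norm_ge0 y; rewrite /f; set s := euclid_norm y in y2 * => s0.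
  rewrite ifT; last by lra.
  rewrite lerXn2r ?nnegrE ?invr_ge0//; last nra.
  by rewrite subr_ge0 expr_le1//; lra.
Qed.

Theorem theorem1p1 (R : realType) (k n : nat) (hk : (1 <= k)%N) (hn : (1 <= n)%N) :
  exists phi : 'rV[R]_n.+1 -> jet R n k,
    biLipschitz_embedding (@euclid_dist R n.+1) (@dcc R n k) (@euclid_sphere R n.+1) phi /\
    ~ (exists psi : 'rV[R]_n.+1 -> jet R n k,
         Lipschitz_map (@euclid_dist R n.+1) (@dcc R n k) (@euclid_ball R n.+1) psi /\
         (forall x, euclid_sphere x -> psi x = phi x)).
Proof.
exists (@sphere_embedding R n k); split; first exact: sphere_embedding_biLipschitz.
by move=> [psi [lip ext]]; exact: (sphere_embedding_no_extension hk hn lip ext).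
Qed.
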